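(* If $\nu$ is a Borel probability measure on $M$ and its stabilizer $G_\nu=\{g\in G: g_*\nu=\nu\}$ is compact, then the map $F_\nu:G\to\mathfrak{k}^*$, $$F_\nu(a):=\int_M\mu(x)\,d(a_*\nu)(x),$$ is a smooth submersion and its image is contained in $\Omega(\mu)$.
   Context: $(M,J,\omega)$ is a compact Kähler manifold with Riemannian metric $g_M$, $\omega(X,Y)=g_M(JX,Y)$. $K$ is a compact connected Lie group with Lie algebra $\mathfrak{k}$ acting on $M$ almost effectively (i.e. $v_M=0$ implies $v=0$ for $v\in\mathfrak{k}$, $v_M$ the fundamental vector field) and by holomorphic isometries. The action is Hamiltonian with momentum mapping $\mu:M\to\mathfrak{k}^*$: $\mu$ is $K$-equivariant and $d\mu^v=i_{v_M}\omega$, where $\mu^v=\langle\mu,v\rangle$. The action extends to a holomorphic action of $G=K^{\mathbb C}$ with $(iv)_M=Jv_M=\operatorname{grad}\mu^v$ for $v \in \mathfrak{k}$. $\Omega(\mu)$ is the interior in $\mathfrak{k}^*$ of the convex hull of $\mu(M)$. *)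

(* Defs.v *)
From HB Require Import structures.
From mathcomp Require Import all_boot all_order all_algebra.
From mathcomp Require Import all_classical all_reals all_analysis.
Set Implicit Arguments.
Unset Strict Implicit.
Unset Printing Implicit Defensive.
Import Order.TTheory GRing.Theory Num.Theory.
Import numFieldNormedType.Exports.
Local Open Scope classical_set_scope.
Local Open Scope ring_scope.

Section Smooth.
Context {R : realType}.

(* For [V] finite dimensional (the only case used) and [U] open, this is the
   usual notion of C^k map: [f] is differentiable on [U] and all its directional
   derivatives are C^(k-1). *)
Fixpoint Ck_on {V W : normedModType R} (k : nat) (U : set V) (f : V -> W) : Prop :=
  match k with
  | 0%N => forall x, U x -> {for x, continuous f}
  | k'.+1 => (forall x, U x -> differentiable f x) /\
             (forall v, Ck_on k' U (fun x => 'd f x v))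
  end.

Definition smooth_on {V W : normedModType R} (U : set V) (f : V -> W) : Prop :=
  forall k, Ck_on k U f.

Record chart (M : topologicalType) (V : normedModType R) := Chart {
  chart_dom : set M;
  chart_cod : set V;
  chart_fun :> M -> V;
  chart_inv : V -> M }.

Definition is_chart (M : topologicalType) (V : normedModType R)
    (c : chart M V) : Prop :=
  [/\ open (chart_dom c) /\ open (chart_cod c),
      forall x, chart_dom c x -> chart_cod c (c x) /\ chart_inv c (c x) = x,
      forall y, chart_cod c y -> chart_dom c (chart_inv c y) /\ c (chart_inv c y) = y,
      forall x, chart_dom c x -> {for x, continuous c} &
      forall y, chart_cod c y -> {for y, continuous (chart_inv c)}].

(* An atlas with a preferred chart [chart_at x] at every point [x]. The tangent
   space at [x] is represented by the model space [V], a vector of [V] being the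
   coordinate vector, in the preferred chart at [x], of a tangent vector. *)
Record charted (M : topologicalType) (V : normedModType R) := Charted {
  atlas : set (chart M V);
  chart_at : M -> chart M V }.

Definition transition (M : topologicalType) (V : normedModType R)
  (c d : chart M V) : V -> V := fun y => d (chart_inv c y).

Definition overlap (M : topologicalType) (V : normedModType R)
  (c d : chart M V) : set V :=
  chart_cod c `&` chart_inv c @^-1` chart_dom d.

Definition is_manifold (M : topologicalType) (V : normedModType R)
    (X : charted M V) : Prop :=
  [/\ hausdorff_space M /\ @second_countable M,
      forall c, atlas X c -> is_chart c,
      forall x, atlas X (chart_at X x) /\ chart_dom (chart_at X x) x &
      forall c d, atlas X c -> atlas X d ->
        smooth_on (overlap c d) (transition c d)].

Definition vchart (W : normedModType R) : chart W W :=
  Chart setT setT id id.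

Definition vcharted (W : normedModType R) : charted W W :=
  Charted [set vchart W] (fun=> vchart W).

Definition prod_chart (M N : topologicalType) (V W : normedModType R)
    (c : chart M V) (d : chart N W) : chart (M * N)%type (V * W)%type :=
  Chart (chart_dom c `*` chart_dom d) (chart_cod c `*` chart_cod d)
    (fun p => (c p.1, d p.2)) (fun q => (chart_inv c q.1, chart_inv d q.2)).

Definition prod_charted (M N : topologicalType) (V W : normedModType R)
    (X : charted M V) (Y : charted N W) : charted (M * N)%type (V * W)%type :=
  Charted [set e | exists c d, [/\ atlas X c, atlas Y d & e = prod_chart c d]]
    (fun p => prod_chart (chart_at X p.1) (chart_at Y p.2)).

Section Maps.
Context {M N : topologicalType} {V W : normedModType R}.
Variables (X : charted M V) (Y : charted N W).

Definition smooth (f : M -> N) : Prop :=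
  continuous f /\
  forall c d, atlas X c -> atlas Y d ->
    smooth_on (chart_cod c `&` chart_inv c @^-1` (f @^-1` chart_dom d))
              (fun y => d (f (chart_inv c y))).

(* differential T_x M -> T_(f x) N *)
Definition mdiff (f : M -> N) (x : M) (v : V) : W :=
  'd (fun y => chart_at Y (f x) (f (chart_inv (chart_at X x) y)))
     (chart_at X x x) v.

Definition submersion (f : M -> N) : Prop :=
  smooth f /\ forall x w, exists v, mdiff f x v = w.

Definition holomorphic (JV : V -> V) (JW : W -> W) (f : M -> N) : Prop :=
  smooth f /\ forall x v, mdiff f x (JV v) = JW (mdiff f x v).

End Maps.

(* C^n as R^n x R^n: the pair (a, b) stands for a + i b. *)
Definition Cn (n : nat) : normedModType R := ('rV[R]_n * 'rV[R]_n)%type.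

Definition Ji {n : nat} (u : Cn n) : Cn n := (- u.2, u.1).

Definition Jprod {m n : nat} (u : Cn m * Cn n) : Cn m * Cn n :=
  (Ji u.1, Ji u.2).

(* The transition maps are holomorphic (Cauchy-Riemann), so that the complex
   structure J of every tangent space is [Ji]. *)
Definition complex_manifold (n : nat) (M : topologicalType)
    (X : charted M (Cn n)) : Prop :=
  is_manifold X /\
  forall c d, atlas X c -> atlas X d -> forall y, overlap c d y ->
    forall u, 'd (transition c d) y (Ji u) = Ji ('d (transition c d) y u).

Section Kaehler.
Context {n : nat} {M : topologicalType}.
Variables (X : charted M (Cn n)) (g : M -> Cn n -> Cn n -> R).

(* [push c y u] is the tangent vector at [chart_inv c y] whose coordinate vector
   in the chart [c] is [u]. *)
Definition push (c : chart M (Cn n)) (y u : Cn n) : Cn n :=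
  'd (transition c (chart_at X (chart_inv c y))) y u.

Definition riemannian_metric : Prop :=
  [/\ forall x a u v w, g x (a *: u + v) w = a * g x u w + g x v w,
      forall x u v, g x u v = g x v u,
      forall x u, u != 0 -> 0 < g x u u &
      forall c, atlas X c -> forall u v,
        smooth_on (chart_cod c)
          (fun y => g (chart_inv c y) (push c y u) (push c y v) : R^o)].

Definition kform (x : M) (u v : Cn n) : R := g x (Ji u) v.

Definition kform_chart (c : chart M (Cn n)) (u v y : Cn n) : R^o :=
  kform (chart_inv c y) (push c y u) (push c y v).

Definition kform_closed : Prop :=
  forall c, atlas X c -> forall y, chart_cod c y -> forall u v w,
    'd (kform_chart c v w) y u + 'd (kform_chart c w u) y v
      + 'd (kform_chart c u v) y w = 0.

Definition kaehler : Prop :=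
  [/\ complex_manifold X, riemannian_metric,
      forall x u v, g x (Ji u) (Ji v) = g x u v & kform_closed].

Definition is_gradient (f : M -> R) (Z : M -> Cn n) : Prop :=
  forall x u, g x (Z x) u = mdiff X (vcharted R^o) (f : M -> R^o) x u.

Definition holomorphic_isometry (f : M -> M) : Prop :=
  [/\ bijective f, holomorphic X X Ji Ji f &
      forall x u v, g (f x) (mdiff X X f x u) (mdiff X X f x v) = g x u v].

End Kaehler.

End Smooth.
Arguments Cn : clear implicits.

(* Only the group and the topology; their compatibility is part of
   [lie_group]. *)
#[short(type="topGroupType")]
HB.structure Definition TopGroup := {G of Group G & Topological G}.

Section LieGroups.
Context {R : realType}.

Definition lie_group (G : topGroupType) (V : normedModType R)
    (X : charted G V) : Prop :=
  [/\ is_manifold X,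
      smooth (prod_charted X X) X (fun p => p.1 * p.2)%g &
      smooth X X (fun h => h^-1)%g].

Definition complex_lie_group (n : nat) (G : topGroupType)
    (X : charted G (Cn R n)) : Prop :=
  [/\ complex_manifold X,
      holomorphic (prod_charted X X) X Jprod Ji (fun p => p.1 * p.2)%g &
      holomorphic X X Ji Ji (fun h => h^-1)%g].

Definition group_hom (G H : topGroupType) (f : G -> H) : Prop :=
  forall a b, f (a * b)%g = (f a * f b)%g.

(* universal property of the complexification [iota : K -> K^C] *)
Definition complexification (k n : nat) (K G : topGroupType)
    (XK : charted K 'rV[R]_k) (XG : charted G (Cn R n)) (iota : K -> G) : Prop :=
  [/\ complex_lie_group XG, group_hom iota, smooth XK XG iota &
      forall (p : nat) (H : topGroupType) (XH : charted H (Cn R p)) (f : K -> H),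
        complex_lie_group XH -> group_hom f -> smooth XK XH f ->
        exists! F : G -> H,
          [/\ group_hom F, holomorphic XG XH Ji Ji F & forall a, F (iota a) = f a]].

Definition is_action (G : topGroupType) (M : Type) (act : G -> M -> M) : Prop :=
  (forall x, act 1%g x = x) /\
  (forall a b x, act (a * b)%g x = act a (act b x)).

(* the fundamental vector field of the element [v] of the Lie algebra T_1 G *)
Definition fundamental (G : topGroupType) (M : topologicalType)
    (V W : normedModType R) (XG : charted G V) (XM : charted M W)
    (act : G -> M -> M) (v : V) (x : M) : W :=
  mdiff XG XM (fun a => act a x) 1%g v.

Definition Ad (G : topGroupType) (V : normedModType R) (X : charted G V)
    (a : G) (v : V) : V :=
  mdiff X X (fun b => a * b * a^-1)%g 1%g v.

(* The dual of the Lie algebra 'rV_k consists of the column vectors. *)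
Definition pairing (k : nat) (xi : 'cV[R]_k) (v : 'rV[R]_k) : R :=
  (v *m xi) 0 0.

Definition momentum_map (k n : nat) (K : topGroupType) (M : topologicalType)
    (XK : charted K 'rV[R]_k) (XM : charted M (Cn R n))
    (g : M -> Cn R n -> Cn R n -> R) (act : K -> M -> M)
    (mu : M -> 'cV[R]_k) : Prop :=
  [/\ smooth XM (vcharted 'cV[R]_k) mu,
      forall a x v, pairing (mu (act a x)) v = pairing (mu x) (Ad XK a^-1%g v) &
      forall v x u,
        mdiff XM (vcharted R^o) (fun y => pairing (mu y) v : R^o) x u
        = kform g x (fundamental XK XM act v x) u].

End LieGroups.

Notation borel M := (g_sigma_algebraType (@open M)).

Section Measures.
Context {R : realType} {G : topGroupType} {M : ptopologicalType}.
Variables (act : G -> M -> M) (nu : probability (borel M) R).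

(* a_* nu *)
Definition push_measure (a : G) : set (borel M) -> \bar R :=
  pushforward nu (act a : borel M -> borel M).

Definition stabilizer : set G :=
  [set a | forall A : set (borel M), measurable A -> push_measure a A = nu A].

Definition Fnu (k : nat) (mu : M -> 'cV[R]_k) (a : G) : 'cV[R]_k :=
  \col_i fine (\int[push_measure a]_x (mu x i 0)%:E).

End Measures.

Definition convex_hull {R : realType} {V : normedModType R} (A : set V) : set V :=
  smallest (@convex_set R V) A.

Definition Omega {R : realType} {k : nat} {M : Type} (mu : M -> 'cV[R]_k) :
  set 'cV[R]_k := interior (convex_hull (range mu)).

(* Main.v *)
Require Import Defs.
From HB Require Import structures.
From mathcomp Require Import all_boot all_order all_algebra.
From mathcomp Require Import all_classical all_reals all_analysis.
From mathcomp Require Import ring lra.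

(** Write [F] for the averaged momentum map and [v_M] for the fundamental field
   of [v].

   The map [F] is smooth because it is the integral, over the compact manifold
   [M], of the family [mu (b x)], which is smooth in [(b, x)]: one differentiates
   under the integral sign ([diff_under_integral], [param_integral_smooth],
   [Fnu_smooth]).

   Moving [a] in the direction of [i v], the component [<F, v>] grows at the rate
   of the integral of [|grad mu^v|^2 = |v_M|^2] against [a_* nu]. Suppose that a
   nonzero [v] annihilates the range of the differential of [F] at [a]. Then this
   integral is zero, so [a_* nu] is carried by the zero set [Z] of [v_M]. The
   contradiction with the compactness of the stabilizer is [fixed_ae_eq0]. The
   group [P] of the elements of [G] that fix [Z] pointwise is closed and, up to
   conjugation by [a], stabilizes [nu]; hence it is compact. An integral curve
   through 1 of the left-invariant field given by [i v] stays in [P], because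
   it moves no zero of [v_M] ([left_integral_curve_exists], [curve_fixes]). For
   any [x] let [y = p x] maximize [mu^v] on the compact orbit [P x]. The curve
   applied to [y] remains in this orbit and starts with velocity
   [grad mu^v (y)], so this gradient is zero, [y] is in [Z], and [x = p^-1 y = y].
   Thus [v_M = 0] everywhere, and [v = 0] since the action is almost effective.
   The integral curve comes from Picard iteration in a chart ([picard_local]).

   The image is then located by convexity alone. If [F a] is not interior to the
   convex hull of [mu (M)], there is a nonzero [v] with [mu^v <= <F a, v>] on [M]
   ([supporting_functional]). Integrating, [<F, v>] is maximal at [a], so [v]
   annihilates the range of the differential of [F] at [a], which has just been
   excluded. *)

Set Implicit Arguments.
Unset Strict Implicit.
Unset Printing Implicit Defensive.
Import Order.TTheory GRing.Theory Num.Theory.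
Import numFieldNormedType.Exports.
Local Open Scope classical_set_scope.
Local Open Scope ring_scope.

(** * Differentials and C^k maps *)

Section Differentials.
Context {R : realType}.
Implicit Types V W Z : normedModType R.

Lemma is_diff_eps V W (f : V -> W) x (df : {linear V -> W}) :
  continuous df ->
  (forall e, 0 < e -> \forall h \near 0, `|f (h + x) - f x - df h| <= e * `|h|) ->
  is_diff x f df.
Proof.
move=> cdf H.
have E : f \o shift x = cst (f x) + df +o_ 0 id.
  apply/eqaddoP => e e0; have := H e e0; apply: filterS => h /=.
  by rewrite -addrA -opprD.
have D := diff_unique cdf E.
by apply: DiffDef => //; apply/diff_locallyP; rewrite D.
Qed.

Lemma is_diff_epsP V W (f : V -> W) x e : differentiable f x -> 0 < e ->
  \forall h \near 0, `|f (h + x) - f x - 'd f x h| <= e * `|h|.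
Proof.
move=> /diff_locallyP[_ /eqaddoP H] e0; have := H e e0; apply: filterS => h /=.
by rewrite -[X in `|X|]/(f (h + x) - (f x + 'd f x h)) opprD addrA.
Qed.

Lemma is_diff_near V W (f g : V -> W) df x :
  (\forall y \near x, f y = g y) -> is_diff x f df -> is_diff x g df.
Proof.
move=> fg fd; have fx : f x = g x by apply: nbhs_singleton fg.
have df' := @ex_diff _ _ _ _ _ _ _ fd.
rewrite -(@diff_val _ _ _ _ _ _ _ fd).
apply: is_diff_eps => [|e e0]; first exact: diff_continuous.
have fg0 : \forall h \near 0, f (h + x) = g (h + x).
  by move: fg; rewrite (near_shift 0) /= subr0; apply: filterS => y.
by have := is_diff_epsP df' e0; apply: filterS2 fg0 => h <-; rewrite -fx.
Qed.

Lemma Ck_continuous V W k (U : set V) (f : V -> W) x :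
  Ck_on k U f -> U x -> {for x, continuous f}.
Proof.
case: k => [|k] /=; first exact.
by case=> H _ Ux; apply: differentiable_continuous; exact: H.
Qed.

Lemma Ck_weaken V W k (U : set V) (f : V -> W) : Ck_on k.+1 U f -> Ck_on k U f.
Proof.
elim: k f => [|k IH] f H; first by move=> x Ux; apply: Ck_continuous H Ux.
by case: H => d H; split => // v; apply: IH.
Qed.

Lemma Ck_sub V W k (U U' : set V) (f : V -> W) :
  U' `<=` U -> Ck_on k U f -> Ck_on k U' f.
Proof.
move=> UU; elim: k f => [|k IH] f /=; first by move=> H x /UU/H.
by case=> H1 H2; split=> [x /UU/H1//|v]; apply: IH.
Qed.

Lemma Ck_eq V W k (U : set V) (f g : V -> W) : open U ->
  (forall x, U x -> f x = g x) -> Ck_on k U f -> Ck_on k U g.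
Proof.
move=> oU; elim: k f g => [|k IH] f g fg /=.
  move=> H x Ux; have Hx : f @ x --> f x := H x Ux.
  change (g @ x --> g x); rewrite -(fg x Ux).
  apply: cvg_trans Hx; apply: near_eq_cvg.
  by have := open_nbhs_nbhs (conj oU Ux); apply: filterS => y /fg.
have nfg x : U x -> \forall y \near x, f y = g y.
  by move=> Ux; have := open_nbhs_nbhs (conj oU Ux); apply: filterS => y /fg.
case=> df H; have D x : U x -> is_diff x g ('d f x).
  by move=> Ux; apply: is_diff_near (nfg x Ux) _; exact/differentiableP/df.
split=> [x Ux|v]; first exact: (@ex_diff _ _ _ _ _ _ _ (D x Ux)).
apply: IH (H v) => x Ux; by rewrite (@diff_val _ _ _ _ _ _ _ (D x Ux)).
Qed.

(** [Ck_on] speaks of ['d f]; an explicit candidate for the derivative lets the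
   rules below be proved by induction on the order of differentiability, the
   induction hypothesis being applied to that candidate. *)
Lemma Ck_intro V W k (U : set V) (f : V -> W) (df : V -> V -> W) : open U ->
  (forall x, U x -> is_diff x f (df x)) ->
  (forall v, Ck_on k U (fun x => df x v)) -> Ck_on k.+1 U f.
Proof.
move=> oU D H; split=> [x /D D'|v]; first exact: ex_diff.
apply: Ck_eq (H v) => // x Ux.
by rewrite (@diff_val _ _ _ _ _ _ _ (D x Ux)).
Qed.

Lemma Ck_is_diff V W k (U : set V) (f : V -> W) x : Ck_on k.+1 U f -> U x ->
  is_diff x f ('d f x).
Proof. by case=> H _ Ux; exact/differentiableP/H. Qed.

Lemma Ck_cst V W k (U : set V) (c : W) : open U -> Ck_on k U (fun=> c).
Proof.
move=> oU; elim: k c => [|k IH] c; first by move=> x _; exact: cst_continuous.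
apply: (@Ck_intro _ _ _ _ _ (fun _ => 0)) => // [x _|v]; exact: IH.
Qed.

Lemma is_diff_lin V W (L : {linear V -> W}) x : continuous L -> is_diff x L L.
Proof.
by move=> cL; apply: DiffDef; [exact: linear_differentiable|exact: diff_lin].
Qed.

Lemma Ck_linpost V W Z k (U : set V) (f : V -> W) (L : {linear W -> Z}) :
  open U -> continuous L -> Ck_on k U f -> Ck_on k U (L \o f).
Proof.
move=> oU cL; elim: k f => [|k IH] f H.
  by move=> x Ux; apply: continuous_comp; [exact: H|exact: cL].
apply: (@Ck_intro _ _ _ _ _ (fun x => L \o 'd f x)) => // [x Ux|v].
  have D1 := Ck_is_diff H Ux; have D2 := @is_diff_lin _ _ L (f x) cL.
  exact: is_diff_comp.
exact: (IH (fun x => 'd f x v)) (H.2 v).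
Qed.

Lemma CkD V W k (U : set V) (f g : V -> W) : open U ->
  Ck_on k U f -> Ck_on k U g -> Ck_on k U (fun x => f x + g x).
Proof.
move=> oU; elim: k f g => [|k IH] f g Hf Hg.
  by move=> x Ux; apply: continuousD; [exact: Hf|exact: Hg].
apply: (@Ck_intro _ _ _ _ _ (fun x => 'd f x \+ 'd g x)) => // [x Ux|v].
  have D1 := Ck_is_diff Hf Ux; have D2 := Ck_is_diff Hg Ux; exact: is_diffD.
exact: (IH (fun x => 'd f x v) (fun x => 'd g x v)) (Hf.2 v) (Hg.2 v).
Qed.

Lemma Ck_sum V W k (U : set V) (I : Type) (r : seq I) (f : I -> V -> W) : open U ->
  (forall i, Ck_on k U (f i)) -> Ck_on k U (fun x => \sum_(i <- r) f i x).
Proof.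
move=> oU H; elim: r => [|i r IH].
  by under eq_fun do rewrite big_nil; exact: Ck_cst.
by under eq_fun do rewrite big_cons; apply: CkD.
Qed.

(** Scalar multiplication is a continuous bilinear map, so this is the rule for
   bilinear maps composed with the pair of [f] and [g]. *)
Lemma is_diff_scale V W (f : V -> R^o) (g : V -> W) x df dg :
  is_diff x f df -> is_diff x g dg ->
  is_diff x (fun y => f y *: g y) (fun v => df v *: g x + f x *: dg v).
Proof.
move=> Df Dg.
have sb : bilinear_for (GRing.Scale.Law.clone _ _ *:%R _)
    (GRing.Scale.Law.clone _ _ *:%R _) (fun (a : R^o) (w : W) => a *: w).
  split=> [u'|u] a y z /=; first by rewrite scalerDl scalerA.
  by rewrite scalerDr !scalerA mulrC.
pose bM := bilinear_isBilinear.Build R R^o W W _ _ _ sb.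
pose b : {bilinear R^o -> W -> W} := HB.pack (fun (a : R^o) (w : W) => a *: w) bM.
have cb : continuous (fun p : R^o * W => b p.1 p.2).
  by move=> p; apply: cvgZ; [exact: cvg_fst|exact: cvg_snd].
have Db : is_diff (f x, g x) (fun p : R^o * W => b p.1 p.2)
    (fun q => b (f x) q.2 + b q.1 (g x)).
  by apply: DiffDef; [exact: differentiable_bilin|exact: diff_bilin].
have Dp := is_diff_pair Df Dg.
have D := is_diff_comp Dp Db.
by apply: (is_diff_eq D); apply/funext => v /=; rewrite addrC.
Qed.

Lemma CkZ V W k (U : set V) (f : V -> R^o) (g : V -> W) : open U ->
  Ck_on k U f -> Ck_on k U g -> Ck_on k U (fun x => f x *: g x).
Proof.
move=> oU; elim: k f g => [|k IH] f g Hf Hg.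
  by move=> x Ux; apply: cvgZ; [exact: Hf|exact: Hg].
apply: (@Ck_intro _ _ _ _ _ (fun x v => 'd f x v *: g x + f x *: 'd g x v)) => //.
  move=> x Ux; have D1 := Ck_is_diff Hf Ux; have D2 := Ck_is_diff Hg Ux.
  exact: is_diff_scale.
move=> v; apply: CkD => //.
- by apply: (IH (fun x => 'd f x v)) => //; [exact: Hf.2|exact: Ck_weaken].
- by apply: (IH _ (fun x => 'd g x v)) => //; [exact: Ck_weaken|exact: Hg.2].
Qed.

End Differentials.

(** * Frames and the chain rule *)

Section Frame.
Context {R : realType}.
Implicit Types V W Z : normedModType R.

(** A basis together with its dual basis. [Ck_on] only controls derivatives in
   fixed directions; expanding a moving direction in a frame is what turns this
   into control of the whole differential. *)
Record frame V := MkFrame {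
  bidx : finType;
  bvec : bidx -> V;
  bcoord : bidx -> {linear V -> R^o};
  bcoord_continuous : forall i, continuous (bcoord i);
  bdec : forall v, v = \sum_i bcoord i v *: bvec i;
  bdual : forall i j, bcoord i (bvec j) = (i == j)%:R }.

End Frame.
Arguments bvec {R V} _ _.
Arguments bcoord {R V} _ _.
Arguments bcoord_continuous {R V} _ _.

Section FrameTheory.
Context {R : realType}.
Implicit Types V W Z : normedModType R.

Definition pair_row_coord (n : nat) (s : 'I_n + 'I_n) (u : Cn R n) : R^o :=
  match s with inl i => u.1 0 i | inr i => u.2 0 i end.
Definition pair_row_vec (n : nat) (s : 'I_n + 'I_n) : Cn R n :=
  match s with inl i => (delta_mx 0 i, 0) | inr i => (0, delta_mx 0 i) end.

Lemma pair_row_coord_linear n (s : 'I_n + 'I_n) : linear (pair_row_coord s).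
Proof. by case: s => i a u v /=; rewrite !mxE. Qed.
HB.instance Definition _ n (s : 'I_n + 'I_n) :=
  GRing.isLinear.Build R (Cn R n) R^o _ (pair_row_coord s) (pair_row_coord_linear s).

Lemma pair_row_coord_continuous n (s : 'I_n + 'I_n) : continuous (pair_row_coord s).
Proof.
case: s => i u /=.
  apply: (@continuous_comp _ _ _ fst (fun v : 'rV[R]_n => v 0 i : R^o)).
    exact: cvg_fst.
  exact: coord_continuous.
apply: (@continuous_comp _ _ _ snd (fun v : 'rV[R]_n => v 0 i : R^o)).
  exact: cvg_snd.
exact: coord_continuous.
Qed.

Lemma pair_row_dec n (v : Cn R n) :
  v = \sum_s pair_row_coord s v *: pair_row_vec s.
Proof.
rewrite big_sumType /= [LHS]surjective_pairing [RHS]surjective_pairing.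
have S1 (I : Type) (r : seq I) (F : I -> Cn R n) : (\sum_(i <- r) F i).1 = \sum_(i <- r) (F i).1.
  exact: (big_morph fst).
have S2 (I : Type) (r : seq I) (F : I -> Cn R n) : (\sum_(i <- r) F i).2 = \sum_(i <- r) (F i).2.
  exact: (big_morph snd).
congr (_, _); rewrite /= ?S1 ?S2 /=.
- rewrite [X in _ + X]big1 ?addr0 => [|i _]; last by rewrite scaler0.
  exact: row_sum_delta.
- rewrite [X in X + _]big1 ?add0r => [|i _]; last by rewrite scaler0.
  exact: row_sum_delta.
Qed.

Lemma pair_row_dual n (s t : 'I_n + 'I_n) :
  pair_row_coord s (pair_row_vec t) = (s == t)%:R.
Proof.
by case: s t => i [] j //=; rewrite !mxE ?eqxx //= eq_sym.
Qed.

Definition Cn_frame n : frame (Cn R n) :=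
  MkFrame (@pair_row_coord_continuous n) (@pair_row_dec n) (@pair_row_dual n).

Section OneFrame.
Variables (V W : normedModType R) (B : frame V).

Lemma frame_linear_continuous (L : {linear V -> W}) : continuous L.
Proof.
have -> : (L : V -> W) = fun v => \sum_i bcoord B i v *: L (bvec B i).
  apply/funext => v; rewrite [in LHS](bdec B v) linear_sum.
  by apply: eq_bigr => i _; rewrite linearZ.
move=> v; apply: cvg_big => [|i _]; first exact: add_continuous.
by apply: cvgZr_tmp; exact: bcoord_continuous.
Qed.

Lemma linear_frameE (L : {linear V -> W}) v :
  L v = \sum_i bcoord B i v *: L (bvec B i).
Proof. by rewrite {1}(bdec B v) linear_sum; apply: eq_bigr => i _; rewrite linearZ. Qed.

(** Unlike the norm, the l^1 norm of the coordinates is not increased by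
   truncating the coordinates one by one. *)
Definition l1 (v : V) : R := \sum_i `|bcoord B i v|.

Lemma l1_le : exists2 C, 0 < C & forall v, l1 v <= C * `|v|.
Proof.
have H i : exists C, 0 < C /\ forall v, `|bcoord B i v| <= C * `|v|.
  by have [C C0 HC] := linear_lipschitz (bcoord_continuous B i); exists C.
have [C HC] := choice H.
exists (1 + \sum_i C i) => [|v].
  by rewrite ltr_wpDr// sumr_ge0// => i _; exact/ltW/(HC i).1.
rewrite mulrDl mul1r mulr_suml ler_wpDl// ler_sum// => i _; exact: (HC i).2.
Qed.

Lemma norm_le_l1 : exists2 C, 0 < C & forall v : V, `|v| <= C * l1 v.
Proof.
exists (1 + \sum_i `|bvec B i|) => [|v]; first by rewrite ltr_wpDr// sumr_ge0.
rewrite {1}(bdec B v) (le_trans (ler_norm_sum _ _ _))// /l1 mulr_sumr ler_sum// => i _.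
rewrite normrZ mulrC ler_wpM2r// ler_wpDl// (bigD1 i)//= lerDl sumr_ge0//.
Qed.

End OneFrame.

(** In ['d h (f x) ('d f x v)] the direction moves with [x], so the induction
   hypothesis does not apply to it. Expanding the direction in a frame of the
   middle space gives a sum of products of functions to which it does. *)
Lemma Ck_comp V W Z (B : frame W) k (U : set V) (U' : set W) (f : V -> W) (h : W -> Z) :
  open U -> open U' -> (forall x, U x -> U' (f x)) ->
  Ck_on k U f -> Ck_on k U' h -> Ck_on k U (fun x => h (f x)).
Proof.
move=> oU oU' fU; elim: k f h fU => [|k IH] f h fU Hf Hh.
  by move=> x Ux; apply: continuous_comp; [exact: Hf|exact/Hh/fU].
apply: (@Ck_intro _ _ _ _ _ _ (fun x v => 'd h (f x) ('d f x v))) => // [x Ux|v].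
  have D1 := Ck_is_diff Hf Ux; have D2 := Ck_is_diff Hh (fU _ Ux).
  exact: is_diff_comp.
under eq_fun do rewrite (linear_frameE B).
apply: Ck_sum => // i; apply: CkZ => //.
  exact: (@Ck_linpost _ _ _ _ _ _ (fun x => 'd f x v) (bcoord B i) oU
    (bcoord_continuous B i) (Hf.2 v)).
exact: (IH f (fun y => 'd h y (bvec B i)) fU (Ck_weaken Hf) (Hh.2 _)).
Qed.

Lemma is_diff_derive V W (f : V -> W) x df v : is_diff x f df ->
  is_derive x v f (df v).
Proof.
move=> D; have D' := @ex_diff _ _ _ _ _ _ _ D; split; first exact: diff_derivable.
by rewrite deriveE // (@diff_val _ _ _ _ _ _ _ D).
Qed.

(** The mean value theorem for the restriction of [f] to the segment from [y] to
   [y + h]. *)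
Lemma MVT_dir V (f : V -> R^o) (y h : V) (df : R -> V -> R) :
  (forall t : R, 0 <= t <= 1 -> is_diff (y + t *: h) f (df t)) ->
  exists2 t, 0 <= t <= 1 & f (y + h) - f y = df t h.
Proof.
move=> H.
pose g (t : R) : R := f (y + t *: h).
have Dg (t : R) : 0 <= t <= 1 -> is_derive (t : R^o) 1 g (df t h).
  move=> t01; have Df := H t t01.
  have Dl : is_diff (t : R^o) (fun s : R^o => y + s *: h) (fun s => s *: h).
    have D1 := is_diff_cst y (t : R^o); have D2 := is_diff_scalel t h.
    have D := is_diffD D1 D2.
    by apply: (is_diff_eq D); apply/funext => s /=; rewrite -[LHS]/(0 + s *: h) add0r.
  have D := is_diff_comp Dl Df.
  by have := is_diff_derive (1 : R^o) D; rewrite /= scale1r.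
have cg : {within `[0, 1], continuous g}.
  apply: derivable_within_continuous => t; rewrite in_itv /= => t01.
  exact: (@ex_derive _ _ _ _ _ _ _ (Dg t t01)).
have H1 (t : R) : t \in `]0, 1[%R -> is_derive (t : R^o) 1 g (df t h).
  by rewrite in_itv /= => /andP[t0 t1]; apply: Dg; rewrite !ltW.
have [t] := MVT ltr01 H1 cg.
rewrite in_itv /= subr0 mulr1 /g scale1r scale0r addr0 => /andP[t0 t1] E.
by exists t => //; rewrite !ltW.
Qed.

End FrameTheory.

(** * Differentiation under the integral sign *)

Section BorelIntegral.
Context {R : realType} {M : ptopologicalType}.
Variable nu : probability (borel M) R.
Hypothesis cM : compact [set: M].

Lemma borel_open (A : set M) : open A -> measurable (A : set (borel M)).
Proof. by move=> oA; exact: sub_sigma_algebra. Qed.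

Lemma borel_measurable_fun (f : M -> R) :
  continuous f -> measurable_fun setT (f : borel M -> R).
Proof.
move=> cf; apply: (measurability _ (measurable_realfun.RGenOpens.measurableE R)).
move=> _ [_ [a [b ->] <-]]; rewrite setTI; apply: borel_open.
by move/continuousP : cf; apply; exact: interval_open.
Qed.

Lemma borel_measurable_self (f : M -> M) :
  continuous f -> measurable_fun setT (f : borel M -> borel M).
Proof.
move=> cf; apply: (@measurability _ _ (borel M) (borel M) _ _ (@open M)) => //.
move=> _ [A oA <-]; rewrite setTI; apply: borel_open.
by move/continuousP : cf; apply.
Qed.

Lemma borel_integrable (f : M -> R) :
  continuous f -> nu.-integrable setT (EFin \o (f : borel M -> R)).
Proof.
move=> cf; apply: measurable_bounded_integrable => //.
- by rewrite (@le_lt_trans _ _ 1%E) ?probability_le1 ?ltry.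
- exact: borel_measurable_fun.
- have : compact (f @` setT).
    by apply: continuous_compact => //; exact: continuous_subspaceT.
  move/compact_bounded => [N [Nr HN]]; exists N; split => // x Nx y _ /=.
  by apply: (HN x Nx); exists y.
Qed.

Lemma Rintegral_bound (f : M -> R) c : continuous f -> (forall x, `|f x| <= c) ->
  `|\int[nu]_x (f : borel M -> R) x| <= c.
Proof.
move=> cf fc; have fi := borel_integrable cf.
apply: (le_trans (le_normr_Rintegral _ fi)) => //.
have -> : c = \int[nu]_(x in [set: borel M]) (cst c) x :> R.
  by rewrite Rintegral_cst//= probability_setT mulr1.
apply: le_Rintegral => //.
  apply: (@borel_integrable (fun x => `|f x|)) => x.
  by apply: continuous_comp; [exact: cf|exact: norm_continuous].
by apply: (@borel_integrable (cst c)); exact: cst_continuous.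
Qed.

End BorelIntegral.

Section UnderIntegral.
Context {R : realType} {M : ptopologicalType} {V : normedModType R}.
Variables (B : frame V) (nu : probability (borel M) R).
Hypothesis cM : compact [set: M].
Variables (U : set V) (phi : V -> M -> R) (dphi : V -> M -> V -> R).
Hypothesis oU : open U.
Hypothesis dphiE : forall y x, U y -> is_diff y (fun z => phi z x : R^o) (dphi y x).
Hypothesis dphi_cont : forall v y x, U y ->
  {for (y, x), continuous (fun p => dphi p.1 p.2 v)}.
Hypothesis phi_cont : forall y, U y -> continuous (phi y).

Lemma dphi_linear y x : U y -> linear (dphi y x : V -> R^o).
Proof.
move=> Uy; have := @diff_val _ _ _ _ _ _ _ (dphiE x Uy) => <- a u v.
by rewrite linearP.
Qed.

Lemma dphi_contx v y : U y -> continuous (fun x => dphi y x v).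
Proof.
move=> Uy x; apply: (@continuous_comp _ _ _ (fun x => (y, x)) (fun p => dphi p.1 p.2 v)).
  by apply: cvg_pair; [exact: cst_continuous|exact: cvg_id].
exact: dphi_cont.
Qed.

(** Compactness of [M] makes the continuity of the differential in [y] uniform in
   [x]; it suffices to know it for the finitely many vectors of a frame. *)
Lemma dphi_uniform y e : U y -> 0 < e ->
  \forall z \near y, U z /\ forall x v, `|dphi z x v - dphi y x v| <= e * l1 B v.
Proof.
move=> Uy e0.
have H i : \forall z \near y, forall x, `|dphi z x (bvec B i) - dphi y x (bvec B i)| < e.
  move/compact_near_coveringP : cM => C.
  have := C V (nbhs y) (fun z x => `|dphi z x (bvec B i) - dphi y x (bvec B i)| < e) _.
  move=> /(_ _) H; have {}H : \forall z \near y, [set: M] `<=` (fun x =>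
     `|dphi z x (bvec B i) - dphi y x (bvec B i)| < e).
    apply: H => x _.
    have c1 := @dphi_cont (bvec B i) y x Uy.
    have c2 := @dphi_contx (bvec B i) y Uy x.
    have e2 : 0 < e / 2 by rewrite divr_gt0.
    have N1 : \forall p \near (y, x), `|dphi y x (bvec B i) - dphi p.1 p.2 (bvec B i)| < e / 2.
      by move/cvgrPdist_lt : c1; exact.
    have N2 : \forall x' \near x, `|dphi y x (bvec B i) - dphi y x' (bvec B i)| < e / 2.
      by move/cvgrPdist_lt : c2; exact.
    case: N1 => -[A1 A2] /= [nA1 nA2] A12.
    exists (A2 `&` [set x' | `|dphi y x (bvec B i) - dphi y x' (bvec B i)| < e / 2], A1).
      by split => //=; exact: filterI.
    move=> [x' z] /= [[A2x' N2x'] A1z].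
    have h1 := A12 (z, x') (conj A1z A2x'); rewrite /= in h1.
    rewrite (_ : _ - _ = (dphi y x (bvec B i) - dphi y x' (bvec B i)) -
       (dphi y x (bvec B i) - dphi z x' (bvec B i))); last by ring.
    by rewrite (le_lt_trans (ler_normB _ _))// (splitr e) ltrD.
  by apply: filterS H => z Hz x; exact: Hz.
have {}H : \forall z \near y, forall i x, `|dphi z x (bvec B i) - dphi y x (bvec B i)| < e.
  by apply: filter_forall => i; exact: H.
have nU : \forall z \near y, U z by exact: open_nbhs_nbhs (conj oU Uy).
near=> z.
have Uz : U z by near: z.
have Hz : forall i x, `|dphi z x (bvec B i) - dphi y x (bvec B i)| < e by near: z.
split => // x v.
have -> : dphi z x v - dphi y x v =
   \sum_i bcoord B i v * (dphi z x (bvec B i) - dphi y x (bvec B i)).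
  have L w : U w -> dphi w x v = \sum_i bcoord B i v * dphi w x (bvec B i).
    move=> Uw; have E := @diff_val _ _ _ _ _ _ _ (dphiE x Uw).
    by rewrite -E (linear_frameE B).
  by rewrite !L// -sumrB; apply: eq_bigr => i _; rewrite mulrBr.
rewrite (le_trans (ler_norm_sum _ _ _))// /l1 mulr_sumr ler_sum// => i _.
by rewrite normrM mulrC ler_wpM2r// ltW.
Unshelve. all: by end_near. Qed.

(** By the mean value theorem the remainder of order one of [phi ^~ x] at [y] is
   the variation of the differential along a short segment applied to the
   increment. By [dphi_uniform] it is small uniformly in [x], and integrating
   against a probability measure preserves the bound. *)
Lemma diff_under_integral y : U y ->
  is_diff y (fun z => \int[nu]_x (phi z : borel M -> R) x : R^o)
    (fun v => \int[nu]_x (fun x : borel M => dphi y x v) x).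
Proof.
move=> Uy.
pose D v : R^o := \int[nu]_x (fun x : borel M => dphi y x v) x.
have DL : linear D.
  move=> a u v; rewrite /D.
  under eq_Rintegral do rewrite dphi_linear//.
  rewrite RintegralD//=; last 2 first.
  - apply: (@borel_integrable _ _ _ cM (fun x => a * dphi y x u)) => x.
    by apply: continuousM; [exact: cst_continuous|exact: dphi_contx].
  - apply: (@borel_integrable _ _ _ cM (fun x => dphi y x v)).
    exact: dphi_contx.
  by rewrite RintegralZl//; apply: (@borel_integrable _ _ _ cM (fun x => dphi y x u)); exact: dphi_contx.
pose DM := GRing.isLinear.Build _ _ _ _ D DL.
pose DD : {linear V -> R^o} := HB.pack D DM.
change (is_diff y (fun z => \int[nu]_x (phi z : borel M -> R) x : R^o) DD).
apply: is_diff_eps => [|e e0]; first exact: (frame_linear_continuous B).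
have [C C0 HC] := l1_le B.
have eC0 : 0 < e / C by rewrite divr_gt0.
have /nbhs_ballP[r /= r0 Hr] := dphi_uniform Uy eC0.
apply/nbhs_ballP; exists r => // h; rewrite -ball_normE /= sub0r normrN => hr.
have near_seg (t : R) : 0 <= t <= 1 -> ball y r (y + t *: h).
  move=> /andP[t0 t1]; rewrite -ball_normE /= opprD addNKr normrN normrZ ger0_norm//.
  by apply: le_lt_trans hr; rewrite ler_piMl.
have Uh : U (h + y).
  by have := (Hr _ (near_seg 1 _)).1; rewrite scale1r addrC; apply; rewrite ler01 lexx.
have est x : `|phi (h + y) x - phi y x - dphi y x h| <= e * `|h|.
  have [t t01] := @MVT_dir _ _ (fun z => phi z x) y h (fun t => dphi (y + t *: h) x)
    (fun t t01 => dphiE x (Hr _ (near_seg t t01)).1).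
  rewrite [h + y]addrC => ->; apply: (le_trans ((Hr _ (near_seg t t01)).2 x h)).
  by rewrite -mulrA ler_wpM2l ?(ltW e0)// ler_pdivrMl.
have i1 : nu.-integrable [set: borel M] (EFin \o (phi (h + y) : borel M -> R)).
  by apply: borel_integrable => //; exact: phi_cont.
have i2 : nu.-integrable [set: borel M] (EFin \o (phi y : borel M -> R)).
  by apply: borel_integrable => //; exact: phi_cont.
have i3 : nu.-integrable [set: borel M] (EFin \o (fun x : borel M => dphi y x h)).
  apply: (@borel_integrable _ _ _ cM (fun x => dphi y x h)); exact: dphi_contx.
have i4 : nu.-integrable [set: borel M]
    (EFin \o (fun x : borel M => phi (h + y) x - phi y x)).
  apply: (@borel_integrable _ _ _ cM (fun x => phi (h + y) x - phi y x)) => x.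
  by apply: continuousB; exact: phi_cont.
rewrite /= /D -!RintegralB//.
apply: (@Rintegral_bound _ _ nu cM (fun x => phi (h + y) x - phi y x - dphi y x h)) => // x.
apply: (@continuousB _ _ _ (fun x => phi (h + y) x - phi y x) (fun x => dphi y x h)); last exact: dphi_contx.
by apply: (@continuousB _ _ _ (phi (h + y)) (phi y)); exact: phi_cont.
Qed.

End UnderIntegral.

(** * Charts and smooth families over a compact manifold *)

Section Charts.
Context {R : realType}.

(** The part of the notion of manifold on which differentials and smoothness of
   composites depend. It passes to products and holds for vector spaces. *)
Definition compatible_charts (M : topologicalType) (V : normedModType R) (X : charted M V) :=
  (forall c, atlas X c -> is_chart c) /\
  (forall x, atlas X (chart_at X x) /\ chart_dom (chart_at X x) x).

Lemma manifold_charts (M : topologicalType) (V : normedModType R) (X : charted M V) :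
  is_manifold X -> compatible_charts X.
Proof. by case. Qed.

Lemma vcharted_charts (W : normedModType R) : compatible_charts (vcharted W).
Proof.
split=> [c ->|x]; last by split.
by split => /=; [split; exact: openT| | |move=> x _; exact: cvg_id|move=> x _; exact: cvg_id].
Qed.

Lemma open_prod (T U : topologicalType) (A : set T) (B : set U) :
  open A -> open B -> open (A `*` B).
Proof.
move=> oA oB; rewrite openE => -[a b] [Aa Bb]; exists (A, B) => //=.
by split; exact: open_nbhs_nbhs.
Qed.

Lemma prod_charts (M N : topologicalType) (V W : normedModType R)
    (X : charted M V) (Y : charted N W) :
  compatible_charts X -> compatible_charts Y -> compatible_charts (prod_charted X Y).
Proof.
move=> [X1 X2] [Y1 Y2]; split=> [_ [c [d [Xc Yd ->]]]|p]; last first.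
  have [? ?] := X2 p.1; have [? ?] := Y2 p.2.
  by split => //=; exists (chart_at X p.1), (chart_at Y p.2).
have [[oc oc'] c1 c2 c3 c4] := X1 _ Xc; have [[od od'] d1 d2 d3 d4] := Y1 _ Yd.
split=> /=.
- by split; exact: open_prod.
- move=> [x y] /= [/c1[? E1] /d1[? E2]]; split => //=; by rewrite E1 E2.
- move=> [x y] /= [/c2[? E1] /d2[? E2]]; split => //=; by rewrite E1 E2.
- move=> [x y] /= [cx dy]; apply: cvg_pair.
    apply: (@continuous_comp _ _ _ fst c); [exact: cvg_fst|exact: c3].
  apply: (@continuous_comp _ _ _ snd d); [exact: cvg_snd|exact: d3].
- move=> [x y] /= [cx dy]; apply: cvg_pair.
    apply: (@continuous_comp _ _ _ fst (chart_inv c)); [exact: cvg_fst|exact: c4].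
  apply: (@continuous_comp _ _ _ snd (chart_inv d)); [exact: cvg_snd|exact: d4].
Qed.

Lemma Ck_local (V W : normedModType R) k (U : set V) (f : V -> W) :
  (forall x, U x -> exists2 U', U' x & Ck_on k U' f) -> Ck_on k U f.
Proof.
elim: k f => [|k IH] f H.
  by move=> x /H[U' U'x HU]; exact: HU.
split=> [x /H[U' U'x HU]|v]; first exact: HU.1.
by apply: IH => x /H[U' U'x HU]; exists U' => //; exact: HU.2.
Qed.

Lemma open_preimage_on (T U : topologicalType) (A : set T) (f : T -> U) (B : set U) :
  open A -> (forall x, A x -> {for x, continuous f}) -> open B ->
  open (A `&` f @^-1` B).
Proof.
move=> oA cf oB; rewrite openE => x [Ax Bfx]; apply: filterI.
  exact: open_nbhs_nbhs.
by apply: cf => //; exact: open_nbhs_nbhs.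
Qed.

Section Comp.
Context {M N P : topologicalType} {V W Z : normedModType R}.
Variables (X : charted M V) (Y : charted N W) (Q : charted P Z) (B : frame W).
Hypotheses (gX : compatible_charts X) (gY : compatible_charts Y) (gQ : compatible_charts Q).

(** The statement is local, so near each point the composite can be factored
   through one chart of the middle manifold, where [Ck_comp] applies. *)
Lemma smooth_comp (f : M -> N) (h : N -> P) :
  smooth X Y f -> smooth Y Q h -> smooth X Q (fun x => h (f x)).
Proof.
move=> [cf sf] [ch sh]; split=> [x|c e Xc Qe k].
  by apply: continuous_comp; [exact: cf|exact: ch].
apply: Ck_local => y [cy ey]; set d := chart_at Y (f (chart_inv c y)).
have [Yd dy] : atlas Y d /\ chart_dom d (f (chart_inv c y)) := gY.2 _.
have [[oc oc'] c1 c2 c3 c4] := gX.1 _ Xc; have [[od od'] d1 d2 d3 d4] := gY.1 _ Yd.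
have [[oe oe'] _ _ _ _] := gQ.1 _ Qe.
pose A := chart_cod c `&` chart_inv c @^-1` (f @^-1` chart_dom d).
pose A' := chart_cod d `&` chart_inv d @^-1` (h @^-1` chart_dom e).
pose A2 := chart_cod c `&` chart_inv c @^-1` (f @^-1` (chart_dom d `&` h @^-1` chart_dom e)).
have cfc z : chart_cod c z -> {for z, continuous (fun z => f (chart_inv c z))}.
  by move=> cz; apply: continuous_comp; [exact: c4|exact: cf].
have oA2 : open A2.
  apply: (@open_preimage_on _ _ _ (fun z => f (chart_inv c z))) => //.
  by apply: open_preimage_on => // x _; exact: ch.
have oA' : open A'.
  apply: (@open_preimage_on _ _ _ (fun z => h (chart_inv d z))) => // x dx.
  by apply: continuous_comp; [exact: d4|exact: ch].
exists A2 => //.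
apply: (@Ck_eq _ _ _ _ _ (fun z => (fun w => e (h (chart_inv d w)))
   ((fun z => d (f (chart_inv c z))) z))) => //.
  by move=> z [_ [dz _]] /=; rewrite (d1 _ dz).2.
apply: (@Ck_comp _ _ _ _ B k A2 A' (fun z => d (f (chart_inv c z))) (fun w => e (h (chart_inv d w)))) => //.
- by move=> z [cz [dz ez]] /=; have [? E] := d1 _ dz; split => //=; rewrite E.
- by apply: Ck_sub (sf c d Xc Yd k) => z [cz [dz ez]].
- exact: sh.
Qed.

End Comp.

End Charts.

Section ParamSmooth.
Context {R : realType} {M : ptopologicalType} {V W : normedModType R}.
Variables (XM : charted M W) (B : frame V) (nu : probability (borel M) R).
Hypotheses (cM : compact [set: M]) (gM : compatible_charts XM).
Variables (U : set V).
Hypothesis oU : open U.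

(** Regularity of order [k] of [phi] on [U `*` M], read in the charts of [M] only.
   This class is stable under differentiation in the parameter
   ([param_diff]), which is what makes the induction in
   [param_integral_smooth] work. *)
Definition param_Ck k (phi : V -> M -> R) := forall d, atlas XM d ->
  Ck_on k (U `*` chart_cod d) (fun q : V * W => phi q.1 (chart_inv d q.2) : R^o).

Lemma param_continuous k phi y x : param_Ck k phi -> U y ->
  {for (y, x), continuous (fun p : V * M => phi p.1 p.2)}.
Proof.
move=> H Uy; have [Xd dx] := gM.2 x; set d := chart_at XM x in Xd dx.
have [[od od'] d1 d2 d3 d4] := gM.1 _ Xd.
have [dxc dxe] := d1 _ dx.
have C := Ck_continuous (H d Xd) (conj Uy dxc : (U `*` chart_cod d) (y, d x)).
have C2 : {for (y, x), continuous (fun p : V * M => phi p.1 (chart_inv d (d p.2)))}.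
  apply: (@continuous_comp _ _ _ (fun p : V * M => (p.1, d p.2))
    (fun q : V * W => phi q.1 (chart_inv d q.2))) => //.
  apply: cvg_pair; first exact: cvg_fst.
  by apply: (@continuous_comp _ _ _ snd d); [exact: cvg_snd|exact: d3].
have E : phi y (chart_inv d (d x)) = phi y x by rewrite dxe.
rewrite /prop_for /continuous_at /= in C2 *; rewrite -E; apply: cvg_trans C2.
apply: near_eq_cvg; exists (setT, chart_dom d).
  by split => /=; [exact: filterT|exact: open_nbhs_nbhs].
by move=> [y' x'] /= [_ dx']; rewrite (d1 _ dx').2.
Qed.

Lemma param_continuousr k phi y : param_Ck k phi -> U y -> continuous (phi y).
Proof.
move=> H Uy x; apply: (@continuous_comp _ _ _ (fun x => (y, x)) (fun p => phi p.1 p.2)).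
  by apply: cvg_pair; [exact: cst_continuous|exact: cvg_id].
exact: param_continuous H Uy.
Qed.

(** The parameter derivative is a directional derivative of the function of both
   variables, in the direction [(v, 0)]. *)
Lemma param_slice k phi d y z : param_Ck k.+1 phi -> atlas XM d -> U y ->
  chart_cod d z ->
  is_diff y (fun y => phi y (chart_inv d z) : R^o)
   (fun v => 'd (fun q : V * W => phi q.1 (chart_inv d q.2) : R^o) (y, z) (v, 0)).
Proof.
move=> H Xd Uy dz.
have D := Ck_is_diff (H d Xd) (conj Uy dz : (U `*` chart_cod d) (y, z)).
have D1 : is_diff y (fun y : V => (y, z)) (fun v => (v, 0)).
  exact: is_diff_pair (is_diff_id y) (is_diff_cst z y).
exact: is_diff_comp D1 D.
Qed.

Lemma param_is_diff k phi y x : param_Ck k.+1 phi -> U y ->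
  is_diff y (fun y => phi y x : R^o) ('d (fun y => phi y x : R^o) y).
Proof.
move=> H Uy; have [Xd dx] := gM.2 x; set d := chart_at XM x in Xd dx.
have [_ d1 _ _ _] := gM.1 _ Xd; have [dxc dxe] := d1 _ dx.
have := param_slice H Xd Uy dxc; rewrite dxe => D.
by apply: differentiableP; exact: (@ex_diff _ _ _ _ _ _ _ D).
Qed.

Lemma param_diff k phi v : param_Ck k.+1 phi ->
  param_Ck k (fun y x => 'd (fun y => phi y x : R^o) y v).
Proof.
move=> H d Xd; have [[_ od'] _ _ _ _] := gM.1 _ Xd.
apply: Ck_eq ((H d Xd).2 (v, 0)); first exact: open_prod.
move=> [y z] [/= Uy dz].
by have D := param_slice H Xd Uy dz; rewrite (@diff_val _ _ _ _ _ _ _ D).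
Qed.

Lemma param_integral_is_diff phi y : (forall k, param_Ck k phi) -> U y ->
  is_diff y (fun y => \int[nu]_x (phi y : borel M -> R) x : R^o)
   (fun v => \int[nu]_x (fun x : borel M => 'd (fun y => phi y x : R^o) y v) x).
Proof.
move=> H Uy.
apply: (@diff_under_integral R M V B nu cM U phi
  (fun y x v => 'd (fun y => phi y x : R^o) y v)) => //.
- by move=> y' x Uy'; exact: param_is_diff (H 1%N) Uy'.
- by move=> v y' x Uy'; exact: param_continuous (param_diff v (H 1%N)) Uy'.
- by move=> y' Uy'; exact: param_continuousr (H 0%N) Uy'.
Qed.

Lemma param_integral_smooth phi : (forall k, param_Ck k phi) ->
  smooth_on U (fun y => \int[nu]_x (phi y : borel M -> R) x : R^o).
Proof.
move=> H k; elim: k phi H => [|k IH] phi H.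
  move=> y Uy; apply: differentiable_continuous.
  exact: (@ex_diff _ _ _ _ _ _ _ (param_integral_is_diff H Uy)).
apply: (Ck_intro oU (fun y Uy => param_integral_is_diff H Uy)) => v.
by apply: IH => k'; exact: param_diff.
Qed.

End ParamSmooth.

(** * Existence of integral curves *)

Section Clamp.
Context {R : realType}.
Implicit Types r s t : R.

Definition clamp r t : R := Num.min r (Num.max (- r) t).

Lemma clampP r t : 0 <= r ->
  [\/ t < - r /\ clamp r t = - r, - r <= t <= r /\ clamp r t = t | r < t /\ clamp r t = r].
Proof.
move=> r0; rewrite /clamp.
case: (ltP t (- r)) => tr; first by constructor 1; rewrite min_r//; lra.
by case: (ltP r t) => rt; [constructor 3|constructor 2; split => //; exact/andP].
Qed.

Lemma clamp_le r t : 0 <= r -> `|clamp r t| <= r.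
Proof.
move=> r0; rewrite ler_norml.
by case: (clampP t r0) => -[] + -> => [?|/andP[? ?]|?]; apply/andP; split; lra.
Qed.

Lemma clamp_id r t : `|t| <= r -> clamp r t = t.
Proof.
move=> tr; have r0 : 0 <= r by rewrite (le_trans _ tr).
move: tr; rewrite ler_norml => /andP[a b].
by case: (clampP t r0) => -[] + -> => ?; lra.
Qed.

Lemma clamp_lip r s t : 0 <= r -> `|clamp r s - clamp r t| <= `|s - t|.
Proof.
move=> r0; have := ler_norm (s - t); have := ler_norm (t - s); rewrite distrC => h1 h2.
rewrite ler_norml.
by case: (clampP s r0) => -[] + -> => [?|/andP[? ?]|?];
  case: (clampP t r0) => -[] + -> => [?|/andP[? ?]|?]; apply/andP; split; lra.
Qed.

Lemma clamp_continuous r : 0 <= r -> continuous (clamp r).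
Proof.
move=> r0 t; apply/cvgrPdist_le => e e0; apply/nbhs_ballP; exists e => //= s.
by rewrite /ball/= => st; apply: le_trans (clamp_lip _ _ r0) (ltW _).
Qed.

End Clamp.

Section Primitive.
Context {R : realType}.
Variable e : R.
Hypothesis e0 : 0 < e.
Let mu := @lebesgue_measure R.

Definition prim0 (f : R -> R) (t : R) : R := \int[mu]_(s in `[- (2 * e), t]) f s.
(** The primitive vanishing at 0, frozen outside [[- e, e]]: it is defined and
   continuous on the whole line, so that iterating it needs no bookkeeping of
   domains. The base point [- (2 * e)] keeps 0 and [- e] in the interior of the
   interval of integration, where the fundamental theorem of calculus holds. *)
Definition prim (f : R -> R) (t : R) : R := prim0 f (clamp e t) - prim0 f 0.

Lemma prim0_diff (f : R -> R) t : continuous f -> - (2 * e) < t < 2 * e ->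
  is_diff (t : R^o) (prim0 f : R^o -> R^o) (fun s => s * f t).
Proof.
move=> cf /andP[t1 t2].
have fi : mu.-integrable `[- (2 * e), 2 * e] (EFin \o f).
  apply: continuous_compact_integrable; first exact: segment_compact.
  exact: continuous_subspaceT.
have [D E] := continuous_FTC1_closed t2 fi t1 (cf t).
have D2 : differentiable (prim0 f : R^o -> R^o) t by apply/derivable1_diffP.
apply: DiffDef => //; rewrite deriv1E//; apply/funext => s /=; by rewrite E.
Qed.

Lemma prim_continuous f : continuous f -> continuous (prim f).
Proof.
move=> cf t.
apply: (@continuousB _ R^o _ (fun t => prim0 f (clamp e t)) (fun=> prim0 f 0)); last exact: cst_continuous.
apply: (@continuous_comp _ _ _ (clamp e) (prim0 f)); first exact: clamp_continuous (ltW e0) _.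
have := @clamp_le _ e t (ltW e0); rewrite ler_norml => /andP[a b].
have H : - (2 * e) < clamp e t < 2 * e by apply/andP; split; have := e0; lra.
have D := @ex_diff _ _ _ _ _ _ _ (prim0_diff cf H).
exact: differentiable_continuous D.
Qed.

Lemma prim_diff f t : continuous f -> `|t| < e ->
  is_diff (t : R^o) (prim f : R^o -> R^o) (fun s => s * f t).
Proof.
move=> cf te; have /andP[a b] : - e < t < e by rewrite -ltr_norml.
have H : - (2 * e) < t < 2 * e by apply/andP; split; have := e0; lra.
have D1 := prim0_diff cf H; have D2 := is_diff_cst (prim0 f 0 : R^o) (t : R^o).
have D := is_diffB D1 D2.
apply: (@is_diff_near _ _ _ (fun t => prim0 f t - prim0 f 0)).
  have : \forall s \near t, `|s| < e.
    apply/nbhs_ballP; exists (e - `|t|) => /=; first by rewrite subr_gt0.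
    move=> s; rewrite /ball /= => st; have := ler_normD (s - t) t; rewrite subrK.
    by rewrite distrC in st; lra.
  by apply: filterS => s /ltW/clamp_id; rewrite /prim => ->.
by apply: (is_diff_eq D); apply/funext => s /=; rewrite -[LHS]/(s * f t - 0) subr0.
Qed.

(** Applied to the difference of two primitives, the mean value theorem gives the
   contraction estimate of the iteration. *)
Lemma prim_mvt f g t : continuous f -> continuous g ->
  exists c, prim f t - prim g t = (f c - g c) * clamp e t.
Proof.
move=> cf cg; set s := clamp e t.
have := @clamp_le _ e t (ltW e0); rewrite -/s => se.
have D (c : R) : 0 <= c <= 1 -> is_diff (0 + c *: s : R^o)
    (fun t => prim0 f t - prim0 g t : R^o) (fun v => v * f (c * s) - v * g (c * s)).
  move=> /andP[c0 c1]; have cs : `|c * s| <= e.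
    by rewrite normrM ger0_norm// (le_trans _ se)// ler_piMl.
  have H : - (2 * e) < c * s < 2 * e.
    by move: cs; rewrite ler_norml => /andP[? ?]; apply/andP; split; have := e0; lra.
  rewrite add0r; have D1 := prim0_diff cf H; have D2 := prim0_diff cg H.
  exact: is_diffB.
have [c _] := MVT_dir D; rewrite add0r => E; exists (c * s).
by rewrite /prim -/s mulrBl (mulrC (f _)) (mulrC (g _)) -E; ring.
Qed.

Lemma prim_at0 f : prim f 0 = 0.
Proof. by rewrite /prim clamp_id ?subrr// normr0 ltW. Qed.

Lemma prim_cst0 t : prim (fun=> 0) t = 0.
Proof. by rewrite /prim /prim0 /Rintegral !integral0 subrr. Qed.

End Primitive.

Section GeometricSequences.
Context {R : realType}.

(** The sequences [u n -+ 2 * D / 2 ^+ n] are monotone and squeeze [u n], so the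
   supremum of the lower one is a limit with an explicit rate. *)
Lemma geo_limit (u : nat -> R) D : (forall n, `|u n.+1 - u n| <= D / 2 ^+ n) ->
  exists l, forall n, `|u n - l| <= 2 * D / 2 ^+ n.
Proof.
move=> H.
have p2 n : 0 < 2 ^+ n :> R by rewrite exprn_gt0.
have D0 : 0 <= D by have := H 0%N; rewrite expr0 divr1; apply: le_trans.
pose a n := u n - 2 * D / 2 ^+ n; pose b n := u n + 2 * D / 2 ^+ n.
have half n : 2 * D / 2 ^+ n.+1 = D / 2 ^+ n.
  by rewrite exprS invfM mulrACA divff// mul1r.
have dbl n : 2 * D / 2 ^+ n = D / 2 ^+ n + D / 2 ^+ n by rewrite -mulrA mulr_natl mulr2n.
have aS n : a n <= a n.+1.
  by have := H n; rewrite ler_norml /a half dbl => /andP[? ?]; lra.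
have bS n : b n.+1 <= b n.
  by have := H n; rewrite ler_norml /b half dbl => /andP[? ?]; lra.
have ab n : a n <= b n.
  have : 0 <= 2 * D / 2 ^+ n by rewrite divr_ge0 ?mulr_ge0// ltW.
  by rewrite /a /b => ?; lra.
have am m n : (m <= n)%N -> a m <= a n.
  by move=> mn; apply: (homo_leq (@lexx _ _) (@le_trans _ _)) mn.
have bm m n : (m <= n)%N -> b n <= b m.
  move=> mn; apply: (@homo_leq _ b (fun x y => y <= x)) mn => // x y z yx zy.
  exact: le_trans zy yx.
have abmn m n : a m <= b n.
  apply: le_trans (am _ _ (leq_maxl m n)) _; apply: le_trans (ab _) _.
  exact: bm (leq_maxr m n).
exists (sup (range a)) => n.
have S1 : a n <= sup (range a).
  apply: sup_upper_bound; last by exists n.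
  split; first by exists (a 0%N), 0%N.
  by exists (b 0%N) => _ [m _ <-].
have S2 : sup (range a) <= b n.
  by apply: ge_sup; [exists (a 0%N), 0%N|move=> _ [m _ <-]].
by rewrite ler_norml; move: S1 S2; rewrite /a /b => *; lra.
Qed.

Lemma geo_small (x K : R) : (forall n, x <= K / 2 ^+ n) -> x <= 0.
Proof.
move=> H; rewrite leNgt; apply/negP => x0.
pose n := (Num.Def.truncn (K / x)).+1.
have p2 : 0 < 2 ^+ n :> R by rewrite exprn_gt0.
have : K / x < 2 ^+ n.
  apply: lt_le_trans (truncnS_gt _) _; rewrite -/n -natrX ler_nat; exact/ltnW/ltn_expl.
rewrite ltr_pdivrMr// => h; have := H n; rewrite ler_pdivlMr// mulrC => h2.
by have := lt_le_trans h h2; rewrite ltxx.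
Qed.

End GeometricSequences.

Lemma sum_cst (R : realType) (I : finType) (c : R) : \sum_(i : I) c = #|I|%:R * c.
Proof. by rewrite sumr_const mulr_natl. Qed.

Section L1.
Context {R : realType} {V : normedModType R}.
Variable B : frame V.

Lemma bcoordZ i a v : bcoord B i (a *: v) = a * bcoord B i v.
Proof. by rewrite linearZ. Qed.

Lemma bcoord_sum (x : bidx B -> R) j : bcoord B j (\sum_i x i *: bvec B i) = x j.
Proof.
rewrite linear_sum (bigD1 j)//= bcoordZ bdual eqxx mulr1 big1 ?addr0// => i ij.
by rewrite bcoordZ bdual eq_sym (negbTE ij) mulr0.
Qed.

Lemma l1_ge0 v : 0 <= l1 B v. Proof. exact: sumr_ge0. Qed.

Lemma bcoord_le_l1 i v : `|bcoord B i v| <= l1 B v.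
Proof. by rewrite /l1 (bigD1 i)//= lerDl sumr_ge0. Qed.

Lemma l1D u v : l1 B (u + v) <= l1 B u + l1 B v.
Proof. by rewrite /l1 -big_split /= ler_sum// => i _; rewrite linearD ler_normD. Qed.

Lemma l1N u : l1 B (- u) = l1 B u.
Proof. by apply: eq_bigr => i _; rewrite linearN normrN. Qed.

Lemma l1_eq0 v : l1 B v <= 0 -> v = 0.
Proof.
move=> H; rewrite (bdec B v) big1// => i _; apply/eqP; rewrite scaler_eq0 -normr_le0.
by rewrite (le_trans (bcoord_le_l1 i v) H).
Qed.

Lemma l1_continuous_dist (T : topologicalType) (y : T -> V) t :
  (forall e, 0 < e -> \forall s \near t, l1 B (y t - y s) <= e) -> {for t, continuous y}.
Proof.
move=> H; have [C C0 HC] := norm_le_l1 B; apply/cvgrPdist_le => e e0.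
have eC : 0 < e / C by rewrite divr_gt0.
apply: filterS (H _ eC) => s Hs; apply: (le_trans (HC _)).
by rewrite mulrC -ler_pdivlMr.
Qed.

Lemma l1_near (T : topologicalType) (y : T -> V) t e : {for t, continuous y} ->
  0 < e -> \forall s \near t, l1 B (y t - y s) <= e.
Proof.
move=> cy e0; have [C C0 HC] := l1_le B.
have eC : 0 < e / C by rewrite divr_gt0.
have : \forall s \near t, `|y t - y s| <= e / C by move/cvgrPdist_le : cy; exact.
by apply: filterS => s Hs; apply: (le_trans (HC _)); rewrite mulrC -ler_pdivlMr.
Qed.

Lemma is_diff_sum (W Z : normedModType R) (I : Type) (r : seq I) (f : I -> W -> Z) df x :
  (forall i, is_diff x (f i) (df i)) ->
  is_diff x (fun y => \sum_(i <- r) f i y) (fun v => \sum_(i <- r) df i v).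
Proof.
move=> H; elim: r => [|i r IH].
  have D := is_diff_cst (0 : Z) x.
  under eq_fun do rewrite big_nil.
  by apply: (is_diff_eq D); apply/funext => v /=; rewrite big_nil.
have D := is_diffD (H i) IH.
under eq_fun do rewrite big_cons.
by apply: (is_diff_eq D); apply/funext => v /=; rewrite big_cons.
Qed.

End L1.

Section Picard.
Context {R : realType} {V : normedModType R}.
Variables (B : frame V) (f : V -> V) (L e : R) (v0 : V).
Hypothesis e_gt0 : 0 < e.
Hypothesis f_lip : forall u v, l1 B (f u - f v) <= L * l1 B (u - v).
Hypothesis L_ge0 : 0 <= L.
Hypothesis small : #|bidx B|%:R * (e * L) <= 2^-1.

Let step (y : R -> V) (t : R) : V :=
  v0 + \sum_i prim e (fun s => bcoord B i (f (y s))) t *: bvec B i.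

Let cf : continuous f.
Proof.
move=> u; apply: (@l1_continuous_dist _ _ B) => d d0.
have d1 : 0 < d / (L + 1) by rewrite divr_gt0// ltr_wpDl.
have := @l1_near _ _ B _ id u _ (@cvg_id _ _) d1; apply: filterS => s h.
apply: le_trans (f_lip _ _) _; apply: le_trans (_ : L * (d / (L + 1)) <= _).
  exact: ler_wpM2l.
by rewrite mulrA ler_pdivrMr ?ltr_wpDl// mulrC ler_wpM2l ?(ltW d0)// lerDl.
Qed.

Let cfy (y : R -> V) i : continuous y -> continuous (fun s => bcoord B i (f (y s))).
Proof.
move=> cy s; apply: (@continuous_comp _ _ _ y (fun v => bcoord B i (f v))); first exact: cy.
by apply: (@continuous_comp _ _ _ f (bcoord B i)); [exact: cf|exact: bcoord_continuous].
Qed.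

Let step_continuous y : continuous y -> continuous (step y).
Proof.
move=> cy t; apply: (@continuousD _ V _ (fun=> v0)); first exact: cst_continuous.
apply: cvg_big => [|i _]; first exact: add_continuous.
by apply: cvgZr_tmp; apply: prim_continuous => //; exact: cfy.
Qed.

Let step_contract y z D : continuous y -> continuous z ->
  (forall s, l1 B (y s - z s) <= D) -> forall t, l1 B (step y t - step z t) <= D / 2.
Proof.
move=> cy cz yz t.
have D0 : 0 <= D by apply: le_trans (l1_ge0 _ _) (yz 0).
have -> : step y t - step z t = \sum_i (prim e (fun s => bcoord B i (f (y s))) t
   - prim e (fun s => bcoord B i (f (z s))) t) *: bvec B i.
  rewrite /step opprD addrACA subrr add0r -sumrB.
  apply: eq_bigr => i _; exact: (esym (scalerBl _ _ _)).
apply: (@le_trans _ _ (\sum_(i : bidx B) e * (L * D))).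
  rewrite /l1; apply: ler_sum => i _; rewrite bcoord_sum.
  have [c ->] := prim_mvt e_gt0 t (@cfy _ i cy) (@cfy _ i cz).
  rewrite normrM mulrC ler_pM// ?clamp_le ?(ltW e_gt0)//.
  rewrite -linearB; apply: le_trans (bcoord_le_l1 _ _) _.
  by apply: le_trans (f_lip _ _) _; rewrite ler_wpM2l.
rewrite sum_cst [leRHS]mulrC.
have -> : #|bidx B|%:R * (e * (L * D)) = #|bidx B|%:R * (e * L) * D by ring.
exact: ler_wpM2r.
Qed.

Let Y (n : nat) := iter n step (fun=> v0).

Let Y_continuous n : continuous (Y n).
Proof.
elim: n => [|n IH]; first exact: cst_continuous.
exact: step_continuous.
Qed.

Let Y_geo : exists D, forall n t, l1 B (Y n.+1 t - Y n t) <= D / 2 ^+ n.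
Proof.
exists (\sum_i e * `|bcoord B i (f v0)|); elim=> [|n IH] t.
  rewrite expr0 divr1 /= {1}/step addrC addKr /l1; apply: ler_sum => i _.
  rewrite bcoord_sum.
  have c1 : continuous (fun _ : R => bcoord B i (f v0)) by exact: cst_continuous.
  have c2 : continuous (fun _ : R => 0 : R) by exact: cst_continuous.
  have [c] := prim_mvt e_gt0 t c1 c2; rewrite prim_cst0 !subr0 => ->.
  by rewrite normrM mulrC ler_wpM2r// clamp_le// ltW.
have := step_contract (@Y_continuous n.+1) (@Y_continuous n) IH t.
by rewrite -mulrA -invfM mulrC -exprSr mulrC.
Qed.

(** Picard iteration. The smallness of [e] makes the integral operator [step] a
   contraction of ratio one half for the uniform l^1 distance, on all of
   [R] thanks to the frozen primitives. The iterates converge coordinatewise at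
   a geometric rate, and the limit is a fixed point of [step]. *)
Lemma picard_global : exists y : R -> V,
  [/\ continuous y, y 0 = v0 &
    forall t, `|t| < e -> is_diff (t : R^o) (y : R^o -> V) (fun s => s *: f (y t))].
Proof.
have [D HD] := Y_geo.
have lim i t : exists l, forall n, `|bcoord B i (Y n t) - l| <= 2 * D / 2 ^+ n.
  apply: (@geo_limit _ (fun n => bcoord B i (Y n t))) => n.
  by rewrite -linearB; exact: le_trans (bcoord_le_l1 _ _) (HD n t).
have [l Hl] := choice (fun p : bidx B * R => lim p.1 p.2).
pose y t : V := \sum_i l (i, t) *: bvec B i.
pose K : R := #|bidx B|%:R * (2 * D).
have Hy n t : l1 B (Y n t - y t) <= K / 2 ^+ n.
  apply: (@le_trans _ _ (\sum_(i : bidx B) 2 * D / 2 ^+ n)).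
    apply: ler_sum => i _; rewrite linearB bcoord_sum; exact: (Hl (i, t)).
  by rewrite sum_cst /K; lra.
have cy : continuous y.
  move=> t; apply: (@l1_continuous_dist _ _ B) => d d0.
  have [n Hn] : exists n, K / 2 ^+ n <= d / 3.
    apply: contrapT => H.
    suff : d / 3 <= 0 by rewrite leNgt divr_gt0.
    by apply: (@geo_small _ _ K) => n; rewrite leNgt; apply/negP => /ltW ?; apply: H; exists n.
  have d3 : 0 < d / 3 by rewrite divr_gt0.
  have := l1_near B (@Y_continuous n t) d3; apply: filterS => s Hs.
  have -> : y t - y s = (- (Y n t - y t) + (Y n t - Y n s)) + (Y n s - y s).
    by rewrite opprB [_ + (_ - Y n s)]addrA subrK addrA subrK.
  have h1 := l1D B (- (Y n t - y t) + (Y n t - Y n s)) (Y n s - y s).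
  have h2 := l1D B (- (Y n t - y t)) (Y n t - Y n s).
  have h3 := Hy n t; have h4 := Hy n s; rewrite l1N in h2; lra.
have fix_y t : step y t = y t.
  apply: subr0_eq; apply: l1_eq0; apply: (@geo_small _ _ K) => n.
  have -> : step y t - y t = - (step (Y n) t - step y t) + (Y n.+1 t - y t).
    rewrite -[Y n.+1 t]/(step (Y n) t); move: (step y t) (step (Y n) t) (y t) => a b c.
    by rewrite opprB addrA subrK.
  apply: le_trans (l1D _ _ _) _; rewrite l1N.
  have h1 := step_contract (@Y_continuous n) cy (Hy n) t; have h2 := Hy n.+1 t.
  have E : K / 2 ^+ n.+1 = K / 2 ^+ n / 2 by rewrite exprSr invfM mulrA.
  rewrite E in h2; lra.
exists y; split => //.
  by rewrite -fix_y /step big1 ?addr0// => i _; rewrite prim_at0 ?scale0r.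
move=> t te; have -> : y = step y by apply/funext => s; rewrite fix_y.
have D1 := is_diff_cst v0 (t : R^o).
have D2 : is_diff (t : R^o)
   (fun t : R^o => \sum_i prim e (fun s => bcoord B i (f (y s))) t *: bvec B i)
   (fun s => \sum_i (s * bcoord B i (f (y t))) *: bvec B i).
  apply: is_diff_sum => i.
  have D3 := prim_diff e_gt0 (@cfy _ i cy) te.
  have D4 := is_diff_scale D3 (is_diff_cst (bvec B i) (t : R^o)).
  by apply: (is_diff_eq D4); apply/funext => s /=; rewrite scaler0 addr0.
have D5 := is_diffD D1 D2.
apply: (is_diff_eq D5); apply/funext => s.
rewrite -[LHS]/(0 + _) add0r fix_y [in RHS](bdec B (f (y t))) scaler_sumr.
by apply: eq_bigr => i _; rewrite scalerA.
Qed.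

End Picard.

Section LocalPicard.
Context {R : realType} {V : normedModType R}.
Variables (B : frame V) (U : set V) (W : V -> V) (v0 : V).
Hypotheses (oU : open U) (Uv0 : U v0) (W_C1 : Ck_on 1 U W).

Let box (r : R) u := forall i, `|bcoord B i (u - v0)| <= r.

Let retract (r : R) (u : V) := v0 + \sum_i clamp r (bcoord B i (u - v0)) *: bvec B i.

Let retract_box r u : 0 <= r -> box r (retract r u).
Proof. by move=> r0 i; rewrite /retract addrC addKr bcoord_sum clamp_le. Qed.

Let retract_id r u : box r u -> retract r u = u.
Proof.
move=> bu; rewrite /retract; under eq_bigr do rewrite clamp_id//.
by rewrite -bdec addrC subrK.
Qed.

Let retract_lip r u v : 0 <= r -> l1 B (retract r u - retract r v) <= l1 B (u - v).
Proof.
move=> r0; have -> : retract r u - retract r v =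
    \sum_i (clamp r (bcoord B i (u - v0)) - clamp r (bcoord B i (v - v0))) *: bvec B i.
  rewrite /retract opprD addrACA subrr add0r -sumrB.
  by apply: eq_bigr => i _; exact: (esym (scalerBl _ _ _)).
apply: ler_sum => i _; rewrite bcoord_sum; apply: le_trans (clamp_lip _ _ r0) _.
by rewrite -linearB opprB addrA subrK.
Qed.

(** The box is chosen inside a ball on which the coordinates of the differential
   stay within distance 1 of their values at [v0]. *)
Let box_bounds : exists2 r, 0 < r &
  exists A, 0 <= A /\ forall u, box r u -> U u /\
    forall i j, `|bcoord B j ('d W u (bvec B i))| <= A.
Proof.
pose a (p : bidx B * bidx B) (u : V) : R := bcoord B p.2 ('d W u (bvec B p.1)).
pose A := 1 + \sum_p `|a p v0|.
have A0 : 0 <= A by rewrite addr_ge0// sumr_ge0.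
have nU : \forall u \near v0, U u by exact: open_nbhs_nbhs.
have nA : \forall u \near v0, forall p, `|a p u| <= A.
  apply: filter_forall => p.
  have cp : {for v0, continuous (a p)}.
    apply: (@continuous_comp _ _ _ (fun u => 'd W u (bvec B p.1)) (bcoord B p.2)).
      exact: (W_C1.2 (bvec B p.1)).
    exact: bcoord_continuous.
  have : \forall u \near v0, `|a p v0 - a p u| <= 1 by move/cvgrPdist_le : cp; exact.
  apply: filterS => u h; have h2 := ler_normB (a p v0) (a p v0 - a p u).
  have h3 : `|a p v0| <= \sum_p `|a p v0| by rewrite (bigD1 p)//= lerDl sumr_ge0.
  by rewrite opprB addrC subrK in h2; rewrite /A; lra.
have nUA : \forall u \near v0, U u /\ forall p, `|a p u| <= A by exact: filterI nU nA.
have [d /= d0 Hd] := (nbhs_ballP _ _).1 nUA.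
have [C C0 HC] := norm_le_l1 B.
(* C * #|bidx B| bounds the norm on the box of half-width 1 *)
pose c : R := C * #|bidx B|%:R + 1.
have c0 : 0 < c by rewrite ltr_wpDl// mulr_ge0// ltW.
exists (d / (2 * c)); first by rewrite divr_gt0// mulr_gt0.
exists A; split => // u bu.
suff /Hd[Uu Au] : ball v0 d u by split => // i j; exact: (Au (i, j)).
rewrite -ball_normE /= distrC; apply: le_lt_trans (HC _) _.
have : l1 B (u - v0) <= #|bidx B|%:R * (d / (2 * c)).
  by rewrite -sum_cst; apply: ler_sum => i _; exact: bu.
rewrite -(ler_pM2l C0) => h; apply: le_lt_trans h _.
set q := d / (2 * c); have q0 : 0 < q by rewrite divr_gt0// mulr_gt0.
have -> : d = q * (2 * c) by rewrite /q divfK// gt_eqF// mulr_gt0.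
have : 0 < q * (C * #|bidx B|%:R + 2) by rewrite mulr_gt0// ltr_wpDl// mulr_ge0// ltW.
rewrite /c; lra.
Qed.

(** A C^1 field is Lipschitz on a small box around [v0]. Precomposing it with the
   retraction onto the box makes it globally Lipschitz without changing it on
   the box, which the solution does not leave for small times. *)
Lemma picard_local : exists2 e : R, 0 < e & exists y : R -> V,
  [/\ continuous y, y 0 = v0 &
    forall t, `|t| < e -> U (y t) /\
       is_diff (t : R^o) (y : R^o -> V) (fun s => s *: W (y t))].
Proof.
have [r r0 [A [A0 HA]]] := box_bounds.
pose f u := W (retract r u).
pose n : R := #|bidx B|%:R.
pose L := n * A.
have L0 : 0 <= L by rewrite mulr_ge0.
have box_seg u v (t : R) : box r u -> box r v -> 0 <= t <= 1 -> box r (u + t *: (v - u)).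
  move=> bu bv /andP[t0 t1] i.
  have -> : u + t *: (v - u) - v0 = (1 - t) *: (u - v0) + t *: (v - v0).
    have -> : v - u = (v - v0) - (u - v0) by rewrite opprB addrA subrK.
    rewrite scalerBr scalerBl scale1r.
    by rewrite addrAC [t *: (v - v0) - _]addrC addrA.
  rewrite linearD !bcoordZ; apply: le_trans (ler_normD _ _) _.
  have t1' : 0 <= 1 - t by rewrite subr_ge0.
  rewrite !normrM (ger0_norm t0) (ger0_norm t1').
  have := bu i; have := bv i => h1 h2.
  have : (1 - t) * `|bcoord B i (u - v0)| <= (1 - t) * r by rewrite ler_wpM2l ?subr_ge0.
  have : t * `|bcoord B i (v - v0)| <= t * r by rewrite ler_wpM2l.
  lra.
have W_lip u v : box r u -> box r v -> l1 B (W v - W u) <= L * l1 B (v - u).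
  move=> bu bv; rewrite /L -mulrA -[n * _]sum_cst; apply: ler_sum => j _.
  have D (t : R) : 0 <= t <= 1 -> is_diff (u + t *: (v - u))
     (fun x => bcoord B j (W x)) (fun h => bcoord B j ('d W (u + t *: (v - u)) h)).
    move=> t01; have Ut := (HA _ (box_seg _ _ _ bu bv t01)).1.
    have D1 := Ck_is_diff W_C1 Ut.
    have D2 := is_diff_lin (W (u + t *: (v - u))) (bcoord_continuous B j).
    exact: is_diff_comp.
  have [t t01] := MVT_dir D; rewrite [u + (v - u)]addrC subrK => E.
  rewrite [X in `|X|]linearB [X in `|X|]E.
  have bt := box_seg _ _ _ bu bv t01.
  rewrite (linear_frameE B ('d W _)) linear_sum; apply: le_trans (ler_norm_sum _ _ _) _.
  rewrite /l1 mulr_sumr; apply: ler_sum => i _.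
  by rewrite bcoordZ normrM mulrC ler_wpM2r//; exact: (HA _ bt).2.
have f_lip u v : l1 B (f u - f v) <= L * l1 B (u - v).
  apply: le_trans (W_lip _ _ (retract_box _ (ltW r0)) (retract_box _ (ltW r0))) _.
  by rewrite ler_wpM2l// retract_lip// ltW.
pose e := (2 * (n + 1) * (L + 1))^-1.
have n0 : 0 <= n by rewrite ler0n.
have e0 : 0 < e by rewrite invr_gt0 !mulr_gt0// ltr_wpDl.
have small : n * (e * L) <= 2^-1.
  have h : n * L <= (n + 1) * (L + 1) by rewrite ler_pM// lerDl.
  have E : e * (2 * (n + 1) * (L + 1)) = 1.
    by rewrite mulVf// gt_eqF// !mulr_gt0// ltr_wpDl.
  have : e * (n * L) <= e * ((n + 1) * (L + 1)) by rewrite ler_wpM2l// ltW.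
  lra.
have [y [cy y0 Dy]] := picard_global v0 e0 f_lip L0 small.
have : \forall t \near (0 : R), l1 B (y 0 - y t) <= r by apply: l1_near => //; exact: cy.
move=> /nbhs_ballP[d /= d0 Hd].
exists (Num.min e d); first by rewrite lt_min e0 d0.
exists y; split => // t; rewrite lt_min => /andP[te td].
have bt : box r (y t).
  move=> i; apply: (le_trans (bcoord_le_l1 i (y t - v0))); rewrite -l1N opprB -y0.
  by apply: Hd; rewrite /ball /= sub0r normrN.
split; first exact: (HA _ bt).1.
by have := Dy t te; rewrite /f (retract_id bt).
Qed.

End LocalPicard.

(** * Supporting half-spaces in finite dimension *)

Section Cones.
Context {R : realType} {V : lmodType R}.

Definition cone (D : set V) :=
  (forall d e, D d -> D e -> D (d + e)) /\ (forall t d, 0 < t -> D d -> D (t *: d)).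

Variables (D : set V) (w : V).
Hypotheses (coneD : cone D) (Dw : ~ D w)
  (absorb : forall u, exists2 t : R, 0 < t & D (u - t *: w)).

Let good (E : set V) := [/\ D `<=` E, cone E & ~ E w].

(** The empty family of sets has an empty union, hence the empty set is added to
   the class to which Zorn's lemma is applied; [D] rules it out afterwards. *)
Let maximal_good_cone : exists E, good E /\ forall E', E `<` E' -> ~ good E'.
Proof.
have [E [gE mE]] : exists E, (E = set0 \/ good E) /\ forall E', E `<` E' -> ~ (E' = set0 \/ good E').
  apply: Zorn_bigcup => F FP Ft.
  have [->|/eqP ne0] := pselect (\bigcup_(X in F) X = set0); first by left.
  have [x [E FE Ex]] := (set0P _).1 ne0.
  right; have gF X y : F X -> X y -> good X.
    by move=> /FP[->|].
  split.
  - have [DE _ _] := gF _ _ FE Ex; by move=> y /DE Ey; exists E.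
  - split=> [d e [X FX Xd] [Y FY Ye]|t d t0 [X FX Xd]].
      have [_ [cX _] _] := gF _ _ FX Xd; have [_ [cY _] _] := gF _ _ FY Ye.
      have [XY|YX] := Ft _ _ FX FY.
        by exists Y => //; apply: cY => //; exact: XY.
      by exists X => //; apply: cX => //; exact: YX.
    have [_ [_ cX] _] := gF _ _ FX Xd.
    by exists X => //; apply: cX.
  - by move=> [X FX Xw]; have [_ _] := gF _ _ FX Xw.
case: gE => [E0|gE]; last by exists E; split=> // E' EE' gE'; apply: (mE E' EE'); right.
have [t _ Dt] := absorb 0.
exfalso; apply: (mE D); last by right; split.
by rewrite E0; split => [//|/(_ _ Dt)].
Qed.

(** A cone [E] containing [D] and maximal among those that avoid [w] is total: each
   vector or its opposite lies in [E], since otherwise both enlargements would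
   reach [w] and two positive combinations would add up to a multiple of [w].
   Hence the [t] with [u + t *: w] in [E] form a half-line; its end depends
   additively and homogeneously on [u], and is finite because [D] absorbs every
   vector in the direction [- w]. This end is the required functional. *)
Lemma cone_functional : exists f : V -> R,
  [/\ forall u v, f (u + v) = f u + f v, forall a u, f (a *: u) = a * f u,
      forall d, D d -> 0 <= f d & f w < 0].
Proof.
have [E [[DE [ED EZ] Ew] maxE]] := maximal_good_cone.
have E0 : E 0.
  apply: contrapT => nE0; apply: (maxE (E `|` [set 0])).
    by split=> [x Ex|/(_ 0)]; [left|move=> H; apply: nE0; apply: H; right].
  split=> [x /DE|//|]; first by left.
    split=> [d e|t d t0] /=.
      move=> [Ed|->] [Ee|->]; rewrite ?addr0 ?add0r; [left|left|left|right] => //.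
      exact: ED.
    by move=> [Ed|->]; rewrite ?scaler0; [left; exact: EZ|right].
  move=> [//|/= w0]; have [t t0 Dt] := absorb w.
  by apply: Dw; move: Dt; rewrite w0 scaler0 subr0.
have tot u : E u \/ E (- u).
  have key x : ~ E x -> exists2 s : R, 0 < s & E (w - s *: x).
    move=> nEx; pose E' y := exists2 s : R, 0 <= s & E (y - s *: x).
    have EE' : E `<` E'.
      split=> [y Ey|H]; first by exists 0; rewrite ?scale0r ?subr0.
      by apply: nEx; apply: H; exists 1; rewrite ?ler01 ?scale1r ?subrr.
    have [s s0 Es] : E' w.
      apply: contrapT => nE'w; apply: (maxE _ EE'); split => //.
        by move=> y /DE Ey; exact: EE'.1.
      split=> [d e [s s0 Es] [r r0 Er]|t d t0 [s s0 Es]].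
        exists (s + r); first exact: addr_ge0.
        by rewrite scalerDl opprD addrACA; exact: ED.
      exists (t * s); first by rewrite mulr_ge0// ltW.
      by rewrite -scalerA -scalerBr; exact: EZ.
    exists s => //; rewrite lt_neqAle s0 andbT eq_sym; apply/eqP => s00.
    by apply: Ew; move: Es; rewrite s00 scale0r subr0.
  apply: contrapT => /not_orP[/key[s s0 Es] /key[r r0 Er]].
  rewrite scalerN opprK in Er.
  have : E (r *: (w - s *: u) + s *: (w + r *: u)) by apply: ED; exact: EZ.
  have -> : r *: (w - s *: u) + s *: (w + r *: u) = (r + s) *: w.
    by rewrite scalerBr scalerDr !scalerA [s * r]mulrC addrACA addNr addr0 -scalerDl.
  move=> /(EZ (r + s)^-1); rewrite scalerA mulVf ?scale1r; last by rewrite gt_eqF// addr_gt0.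
  by move=> H; apply: Ew; apply: H; rewrite invr_gt0 addr_gt0.
have Ewt t : E (t *: w) -> t <= 0.
  move=> Et; rewrite leNgt; apply/negP => t0; apply: Ew.
  have := EZ t^-1 _ _ Et; rewrite scalerA mulVf ?gt_eqF// scale1r; apply.
  by rewrite invr_gt0.
(* T u is a half-line unbounded below; its supremum is the threshold *)
pose T u := [set t : R | E (u + t *: w)].
have T0 u : T u !=set0.
  by have [t _ Dt] := absorb u; exists (- t); rewrite /T /= scaleNr; exact: DE.
have TT u s t : T u s -> T (- u) t -> s + t <= 0.
  move=> Ts Tt; apply: Ewt; have := ED _ _ Ts Tt.
  by rewrite addrACA subrr add0r -scalerDl.
have Tsup u : has_sup (T u).
  split; first exact: T0.
  have [t Tt] := T0 (- u); exists (- t) => s Ts.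
  by have := TT _ _ _ Ts Tt; lra.
pose f u := sup (T u).
have Tf u t : T u t -> t <= f u by move=> Tt; exact: sup_upper_bound.
have fle u c : (forall t, T u t -> t <= c) -> f u <= c.
  by move=> H; apply: ge_sup => //; exact: T0.
have fN u : f (- u) = - f u.
  apply/eqP; rewrite eq_le; apply/andP; split.
    apply: (fle _ _) => t Tt; rewrite lerNr; apply: (fle _ _) => s Ts.
    by have := TT _ _ _ Ts Tt; lra.
  rewrite lerNl; apply/ler_addgt0Pl => d d0.
  have nT : ~ T u (f u + d) by move=> /Tf; lra.
  case: (tot (u + (f u + d) *: w)) => // H.
  suff /Tf : T (- u) (- (f u + d)) by lra.
  by rewrite /T /= scaleNr -opprD.
have fsup u v : f u + f v <= f (u + v).
  rewrite -lerBrDr; apply: (fle _ _) => s Ts; rewrite lerBrDr -lerBrDl.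
  apply: (fle _ _) => t Tt; rewrite lerBrDl; apply: Tf.
  by rewrite /T /= scalerDl addrACA; exact: ED.
have fD u v : f (u + v) = f u + f v.
  have h := fsup (- u) (- v); rewrite -opprD !fN in h.
  by apply/eqP; rewrite eq_le fsup andbT; lra.
have fZpos a u : 0 < a -> a * f u <= f (a *: u).
  move=> a0; rewrite mulrC -ler_pdivlMr//; apply: (fle _ _) => t Tt.
  rewrite ler_pdivlMr//; apply: Tf; rewrite /T /= mulrC -scalerA -scalerDr.
  exact: EZ.
have fZp a u : 0 < a -> f (a *: u) = a * f u.
  move=> a0; apply/eqP; rewrite eq_le fZpos// andbT.
  have := fZpos a^-1 (a *: u); rewrite scalerA mulVf ?gt_eqF// scale1r invr_gt0 => /(_ a0).
  by rewrite ler_pdivrMl.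
have f0 : f 0 = 0 by have := fD 0 0; rewrite addr0; lra.
exists f; split => //.
- move=> a u; have [a0|a0|->] := ltrgtP a 0.
  + rewrite -[a]opprK scaleNr fN fZp ?oppr_gt0//; by rewrite !mulNr.
  + exact: fZp.
  + by rewrite scale0r mul0r.
- by move=> d Dd; apply: Tf; rewrite /T /= scale0r addr0; exact: DE.
- apply: (@le_lt_trans _ _ (-1)); last by rewrite oppr_lt0.
  apply: (fle _ _) => t; rewrite /T /= -[X in X + _]scale1r -scalerDl => /Ewt.
  by lra.
Qed.

End Cones.

Section Support.
Context {R : realType} {k : nat}.
Local Notation V := 'cV[R]_k.

Lemma pairing_sum (d : V) (v : 'rV[R]_k) : pairing d v = \sum_i v 0 i * d i 0.
Proof. by rewrite /pairing mxE. Qed.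

Lemma pairingD (c d : V) v : pairing (c + d) v = pairing c v + pairing d v.
Proof. by rewrite /pairing mulmxDr mxE. Qed.

Lemma pairingZ a (d : V) v : pairing (a *: d) v = a * pairing d v.
Proof. by rewrite /pairing -scalemxAr mxE. Qed.

Lemma cone_sum (D : set V) (x : V) (I : Type) (r : seq I) (s : I -> R) (b : I -> V) :
  cone D -> D x -> (forall i, 0 < s i) -> (forall i, D (b i)) ->
  D (x + \sum_(i <- r) s i *: b i).
Proof.
move=> [DD DZ] Dx s0 Db; elim: r => [|i r IH]; first by rewrite big_nil addr0.
by rewrite big_cons addrCA; apply: DD => //; apply: DZ.
Qed.

(** Take vectors of [D] spanning as large a subspace as possible. If they do not
   span everything, a functional vanishing on them vanishes on [D]. If they do,
   the opposite [w] of their sum is not in [D], for otherwise [D] would be the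
   whole space, and every vector falls into [D] once enough of [w] is removed:
   [cone_functional] applies. *)
Lemma cone_half_space (D : set V) (u0 : V) : cone D -> D !=set0 -> ~ D u0 ->
  exists2 v : 'rV[R]_k, v != 0 & forall d, D d -> pairing d v <= 0.
Proof.
move=> coneD [d0 Dd0] nDu0.
pose P r := `[< exists m (B : 'M[R]_(m, k)), (forall i, D (row i B)^T) /\ \rank B = r >].
have exP : exists r, P r.
  exists 0%N; apply/asboolP; exists 0%N, 0; split; last exact: mxrank0.
  by case.
have leP r : P r -> (r <= k)%N.
  by move=> /asboolP[m [B [_ <-]]]; exact: rank_leq_col.
case: (ex_maxnP exP leP) => r /asboolP[m [B [DB rB]]] maxr {exP}.
have sub d : D d -> (d^T <= B)%MS.
  move=> Dd; pose C := col_mx B d^T.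
  have rC : (\rank C <= r)%N.
    apply: maxr; apply/asboolP; exists (m + 1)%N, C; split => // i.
    case: (split_ordP i) => j ->; first by rewrite rowKu.
    by rewrite rowKd row_id trmxK.
  have CB : (B :=: C)%MS.
    apply/eqmxP; rewrite -mxrank_leqif_eq ?rB.
      by rewrite eqn_leq rC -rB mxrankS // /C -addsmxE addsmxSl.
    by rewrite /C -addsmxE addsmxSl.
  by rewrite CB /C -addsmxE addsmxSr.
have [rk|rk] := ltnP r k.
  have : kermx B^T != 0.
    by rewrite -mxrank_eq0 mxrank_ker mxrank_tr rB subn_eq0 -ltnNge.
  move=> /rowV0Pn[v vk v0]; exists v => // d /sub/submxP[c dE].
  have vB : v *m B^T = 0 by apply/sub_kermxP.
  by rewrite /pairing -[d]trmxK dE trmx_mul mulmxA vB mul0mx mxE.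
pose b i : V := (row i B)^T.
pose w : V := - \sum_i b i.
have fullB : row_full B.
  by rewrite /row_full rB eqn_leq rk andbT leP//; apply/asboolP; exists m, B.
have expand (u : V) : exists c : 'I_m -> R, u = \sum_i c i *: b i.
  have /submxP[c uE] := submx_full u^T fullB.
  exists (fun i => c 0 i); rewrite -[LHS]trmxK uE mulmx_sum_row linear_sum.
  by apply: eq_bigr => i _; rewrite linearZ.
(* t exceeds the coefficients of u - d0, so that adding t to each makes all of
   them positive *)
have shift u : exists2 t, 0 < t & exists2 s : 'I_m -> R, (forall i, 0 < s i) &
    u - t *: w = d0 + \sum_i s i *: b i.
  have [c uE] := expand (u - d0).
  pose t := 1 + \sum_i `|c i|.
  exists t; first by rewrite ltr_wpDr// sumr_ge0.
  exists (fun i => c i + t) => [i|].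
    have : `|c i| <= \sum_i `|c i| by rewrite (bigD1 i)//= lerDl sumr_ge0.
    have := ler_norm (- c i); rewrite normrN /t => h1 h2; lra.
  under eq_bigr do rewrite scalerDl.
  by rewrite big_split /= -uE -scaler_sumr addrA [d0 + _]addrC subrK /w scalerN opprK.
have absorb u : exists2 t, 0 < t & D (u - t *: w).
  by have [t t0 [s s0 E]] := shift u; exists t => //; rewrite E; exact: cone_sum.
have nDw : ~ D w.
  move=> Dw; apply: nDu0; have [t t0 Dt] := absorb u0.
  by rewrite -(subrK (t *: w) u0); apply: coneD.1 => //; exact: coneD.2.
have [f [fD fZ fpos fw]] := cone_functional coneD nDw absorb.
have f0 : f 0 = 0 by rewrite -(scale0r (0 : V)) fZ mul0r.
have fE d : f d = \sum_i d i 0 * f (delta_mx i 0).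
  have fsum (I : Type) (r' : seq I) (F : I -> V) : f (\sum_(i <- r') F i) = \sum_(i <- r') f (F i).
    exact: (big_morph f).
  rewrite {1}(matrix_sum_delta d) fsum; apply: eq_bigr => i _.
  by rewrite big_ord1 fZ.
exists (\row_i - f (delta_mx i 0)).
  apply/eqP => v0; move: fw; rewrite fE big1 ?ltxx// => i _.
  have := congr1 (fun v : 'rV[R]_k => v 0 i) v0.
  by rewrite !mxE => /eqP; rewrite oppr_eq0 => /eqP ->; rewrite mulr0.
move=> d /fpos; rewrite fE pairing_sum => h.
rewrite -oppr_ge0 -sumrN; apply: le_trans h _; rewrite le_eqVlt; apply/orP; left; apply/eqP.
by apply: eq_bigr => i _; rewrite mxE mulNr opprK mulrC.
Qed.

Definition convex (A : set V) := forall x y t, A x -> A y -> 0 <= t <= 1 ->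
  A (t *: x + (1 - t) *: y).

(** If [A] contains a segment starting at [p] in each direction, it contains
   segments around [p] along the coordinate axes. Averaging two points at a
   time yields a box around [p], its size being halved for each axis. *)
Lemma convex_interior (A : set V) p : convex A ->
  (forall d : V, exists2 t : R, 0 < t & A (p + t *: d)) -> nbhs p A.
Proof.
move=> cA H.
have Ap : A p by have [t _] := H 0; rewrite scaler0 addr0.
have seg (d : V) (t s : R) : A (p + t *: d) -> 0 < t -> 0 <= s <= t -> A (p + s *: d).
  move=> At t0 /andP[s0 st].
  have -> : p + s *: d = (s / t) *: (p + t *: d) + (1 - s / t) *: p.
    rewrite scalerDr scalerA divfK ?gt_eqF// scalerBl scale1r.
    by rewrite [p - _]addrC addrACA subrr add0r addrC.
  by apply: cA => //; rewrite divr_ge0 ?(ltW t0)//= ler_pdivrMr// mul1r.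
have axis (d : V) : exists2 t : R, 0 < t & forall s, `|s| <= t -> A (p + s *: d).
  have [t t0 At] := H d; have [r r0 Ar] := H (- d).
  exists (Num.min t r); first by rewrite lt_min t0 r0.
  move=> s; rewrite le_min => /andP[st sr]; have [s0|s0] := leP 0 s.
    by apply: seg At t0 _; rewrite s0 /= -(ger0_norm s0).
  rewrite -[s *: d]opprK -scaleNr -scalerN; apply: seg Ar r0 _.
  by rewrite oppr_ge0 (ltW s0) /= -(ltr0_norm s0).
have box (r : seq 'I_k) : exists2 t : R, 0 < t & forall x : 'I_k -> R,
    (forall i, `|x i| <= t) -> A (p + \sum_(i <- r) x i *: delta_mx i 0).
  elim: r => [|i r [t t0 IH]].
    by exists 1 => // x _; rewrite big_nil addr0.
  have [s s0 As] := axis (delta_mx i 0).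
  exists (Num.min t s / 2); first by rewrite divr_gt0// lt_min t0 s0.
  move=> x xs; rewrite big_cons.
  have x2 j : `|2 * x j| <= Num.min t s.
    by rewrite normrM ger0_norm// mulrC -ler_pdivlMr.
  have -> : p + (x i *: delta_mx i 0 + \sum_(j <- r) x j *: delta_mx j 0) =
     2^-1 *: (p + (2 * x i) *: delta_mx i 0) +
     (1 - 2^-1) *: (p + \sum_(j <- r) (2 * x j) *: delta_mx j 0).
    have -> : 1 - 2^-1 = 2^-1 :> R by lra.
    under [in RHS]eq_bigr do rewrite -scalerA.
    rewrite -scaler_sumr !scalerDr !scalerA mulrA mulVf// mul1r scale1r.
    have half : 2^-1 + 2^-1 = 1 :> R by lra.
    by rewrite addrACA -scalerDl half scale1r.
  apply: cA; last by apply/andP; split; lra.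
    by apply: As; apply: le_trans (x2 i) _; rewrite ge_min lexx orbT.
  by apply: IH => j; apply: le_trans (x2 j) _; rewrite ge_min lexx.
have [t t0 Ht] := box (index_enum 'I_k).
apply/nbhs_ballP; exists t => // q; rewrite -ball_normE /= => qt.
have -> : q = p + \sum_i (q - p) i 0 *: delta_mx i 0.
  rewrite -[LHS](subrK p) addrC; congr (_ + _).
  by rewrite [LHS]matrix_sum_delta; apply: eq_bigr => i _; rewrite big_ord1.
apply: Ht => i; apply: le_trans (ltW qt); rewrite distrC.
rewrite [leRHS]/Num.Def.normr /= mx_normrE.
exact: (le_bigmax _ (fun ij : 'I_k * 'I_1 => `|(q - p) ij.1 ij.2|) (i, 0)).
Qed.

(** The directions in which [A] can be entered from [p] form a convex cone, which is
   not everything by [convex_interior], so it lies in a half-space. *)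
Lemma supporting_functional (A : set V) (p : V) : convex A -> A !=set0 -> ~ A^° p ->
  exists2 v : 'rV[R]_k, v != 0 & forall x, A x -> pairing x v <= pairing p v.
Proof.
move=> cA [x0 Ax0] nAp.
pose D d := exists2 t : R, 0 < t & A (p + t *: d).
have coneD : cone D.
  split=> [d e [t t0 At] [s s0 As]|t d t0 [s s0 As]]; last first.
    exists (s / t); first exact: divr_gt0.
    by rewrite scalerA divfK// gt_eqF.
  have ts : 0 < t + s by exact: addr_gt0.
  exists (t * s / (t + s)); first by rewrite divr_gt0// mulr_gt0.
  have -> : p + (t * s / (t + s)) *: (d + e) =
      (s / (t + s)) *: (p + t *: d) + (1 - s / (t + s)) *: (p + s *: e).
    have -> : 1 - s / (t + s) = t / (t + s) by rewrite -[1](@divff _ (t + s)) ?gt_eqF// -mulrBl addrK.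
    rewrite !scalerDr !scalerA addrACA -scalerDl -mulrDl [s + t]addrC divff ?gt_eqF// scale1r.
    by congr (_ + (_ *: _ + _ *: _)); ring.
  apply: cA => //; apply/andP; split; first by rewrite divr_ge0// ltW.
  by rewrite ler_pdivrMr// mul1r lerDr ltW.
have [u nDu] : exists u, ~ D u.
  apply: contrapT => H; apply: nAp; apply: convex_interior => // d.
  by apply: contrapT => nDd; apply: H; exists d.
have [|v v0 Hv] := cone_half_space coneD _ nDu.
  by exists (x0 - p), 1; rewrite // scale1r addrC subrK.
exists v => // x Ax; have : D (x - p) by exists 1; rewrite // scale1r addrC subrK.
by move=> /Hv; rewrite pairingD -scaleN1r pairingZ; lra.
Qed.

Lemma convex_hull_convex (A : set V) : convex (convex_hull A).
Proof.
move=> x y t hx hy t01 C [/= cC AC].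
have Cx := hx C (conj cC AC); have Cy := hy C (conj cC AC).
have [t0 t1] := andP t01.
exact: (set_mem (cC x y (Itv01 t0 t1) (mem_set Cx) (mem_set Cy))).
Qed.

End Support.

(** * Smooth maps between manifolds *)

Section SmoothMaps.
Context {R : realType}.
Implicit Types M N P : topologicalType.

Lemma pairl_continuous (T U : topologicalType) (u : U) : continuous (fun t : T => (t, u)).
Proof. by move=> t; apply: cvg_pair; [exact: cvg_id|exact: cst_continuous]. Qed.

Lemma pairr_continuous (T U : topologicalType) (t : T) : continuous (fun u : U => (t, u)).
Proof. by move=> u; apply: cvg_pair; [exact: cst_continuous|exact: cvg_id]. Qed.

Lemma Ck_slice (V W Z : normedModType R) k (A : set (V * W)) (f : V * W -> Z) w :
  open A -> Ck_on k A f -> Ck_on k [set y | A (y, w)] (fun y => f (y, w)).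
Proof.
move=> oA; have cp := @pairl_continuous V W w.
have oS : open [set y | A (y, w)] by apply: open_comp => // y _; exact: cp.
elim: k f => [|k IH] f H.
  move=> y Ay; apply: (@continuous_comp _ _ _ (fun y => (y, w)) f); [exact: cp|exact: H].
apply: (@Ck_intro _ _ _ _ _ _ (fun y v => 'd f (y, w) (v, 0))) => // [y Ay|v].
  have D1 : is_diff y (fun y : V => (y, w)) (fun v => (v, 0)).
    exact: is_diff_pair (is_diff_id y) (is_diff_cst w y).
  exact: is_diff_comp D1 (Ck_is_diff H Ay).
exact: (IH (fun q => 'd f q (v, 0))) (H.2 _).
Qed.

Lemma Ck_slice2 (V W Z : normedModType R) k (A : set (V * W)) (f : V * W -> Z) v0 :
  open A -> Ck_on k A f -> Ck_on k [set y | A (v0, y)] (fun y => f (v0, y)).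
Proof.
move=> oA; have cp := @pairr_continuous V W v0.
have oS : open [set y | A (v0, y)] by apply: open_comp => // y _; exact: cp.
elim: k f => [|k IH] f H.
  move=> y Ay; apply: (@continuous_comp _ _ _ (fun y => (v0, y)) f); [exact: cp|exact: H].
apply: (@Ck_intro _ _ _ _ _ _ (fun y v => 'd f (v0, y) (0, v))) => // [y Ay|v].
  have D1 : is_diff y (fun y : W => (v0, y)) (fun v => (0, v)).
    exact: is_diff_pair (is_diff_cst v0 y) (is_diff_id y).
  exact: is_diff_comp D1 (Ck_is_diff H Ay).
exact: (IH (fun q => 'd f q (0, v))) (H.2 _).
Qed.

Lemma smooth_slice (M N P : topologicalType) (V W Z : normedModType R)
    (X : charted M V) (Y : charted N W) (Q : charted P Z) (f : M * N -> P) n :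
  compatible_charts X -> compatible_charts Y -> compatible_charts Q ->
  smooth (prod_charted X Y) Q f -> smooth X Q (fun x => f (x, n)).
Proof.
move=> gX gY gQ [cf sf]; split=> [x|c e Xc Qe k].
  by apply: (@continuous_comp _ _ _ (fun x => (x, n)) f); [exact: pairl_continuous|exact: cf].
have [Yd dn] := gY.2 n; set d := chart_at Y n in Yd dn.
have [_ d1 _ _ _] := gY.1 _ Yd; have [dn' dnE] := d1 _ dn.
have Xcd : atlas (prod_charted X Y) (prod_chart c d) by exists c, d.
have [[_ ocd] _ _ _ ccd] := (prod_charts gX gY).1 _ Xcd.
have [[oe _] _ _ _ _] := gQ.1 _ Qe.
have oA : open (chart_cod (prod_chart c d) `&`
    chart_inv (prod_chart c d) @^-1` (f @^-1` chart_dom e)).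
  apply: (@open_preimage_on _ _ _ (fun q => f (chart_inv (prod_chart c d) q))) => // q qc.
  by apply: continuous_comp; [exact: ccd|exact: cf].
have := Ck_slice (d n) oA (sf _ e Xcd Qe k).
have -> : (fun y => e (f (chart_inv (prod_chart c d) (y, d n)))) =
  (fun y => e (f (chart_inv c y, n))) by apply/funext => y /=; rewrite dnE.
by apply: Ck_sub => y /= [cy ey]; rewrite dnE.
Qed.

Lemma smooth_slice2 (M N P : topologicalType) (V W Z : normedModType R)
    (X : charted M V) (Y : charted N W) (Q : charted P Z) (f : M * N -> P) m :
  compatible_charts X -> compatible_charts Y -> compatible_charts Q ->
  smooth (prod_charted X Y) Q f -> smooth Y Q (fun y => f (m, y)).
Proof.
move=> gX gY gQ [cf sf]; split=> [x|d e Yd Qe k].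
  by apply: (@continuous_comp _ _ _ (fun y => (m, y)) f); [exact: pairr_continuous|exact: cf].
have [Xc cm] := gX.2 m; set c := chart_at X m in Xc cm.
have [_ c1 _ _ _] := gX.1 _ Xc; have [cm' cmE] := c1 _ cm.
have Xcd : atlas (prod_charted X Y) (prod_chart c d) by exists c, d.
have [[_ ocd] _ _ _ ccd] := (prod_charts gX gY).1 _ Xcd.
have [[oe _] _ _ _ _] := gQ.1 _ Qe.
have oA : open (chart_cod (prod_chart c d) `&`
    chart_inv (prod_chart c d) @^-1` (f @^-1` chart_dom e)).
  apply: (@open_preimage_on _ _ _ (fun q => f (chart_inv (prod_chart c d) q))) => // q qc.
  by apply: continuous_comp; [exact: ccd|exact: cf].
have := Ck_slice2 (c m) oA (sf _ e Xcd Qe k).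
have -> : (fun y => e (f (chart_inv (prod_chart c d) (c m, y)))) =
  (fun y => e (f (m, chart_inv d y))) by apply/funext => y /=; rewrite cmE.
by apply: Ck_sub => y /= [cy ey]; rewrite cmE.
Qed.

Section Chain.
Context {M N P : topologicalType} {V W Z : normedModType R}.
Variables (X : charted M V) (Y : charted N W) (Q : charted P Z).
Hypotheses (gX : compatible_charts X) (gY : compatible_charts Y) (gQ : compatible_charts Q).

Lemma smooth_chart_diff (f : M -> N) c d y : smooth X Y f -> atlas X c -> atlas Y d ->
  chart_cod c y -> chart_dom d (f (chart_inv c y)) ->
  is_diff y (fun y => d (f (chart_inv c y))) ('d (fun y => d (f (chart_inv c y))) y).
Proof. by move=> [_ sf] Xc Yd cy dy; exact: (Ck_is_diff (sf c d Xc Yd 1%N)). Qed.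

Lemma mdiff_is_diff (f : M -> N) x : smooth X Y f ->
  is_diff (chart_at X x x)
    (fun y => chart_at Y (f x) (f (chart_inv (chart_at X x) y))) (mdiff X Y f x).
Proof.
move=> sf; have [Xc cx] := gX.2 x; have [Yd dx] := gY.2 (f x).
have [_ c1 _ _ _] := gX.1 _ Xc; have [cx' cxE] := c1 _ cx.
by apply: smooth_chart_diff => //; rewrite cxE.
Qed.

(** The middle chart [d] is arbitrary: along a curve the chart must stay fixed while
   the point moves, so the preferred charts of [mdiff] would not do. *)
Lemma chart_chain (f : M -> N) (h : N -> P) c d e y : smooth X Y f -> smooth Y Q h ->
  atlas X c -> atlas Y d -> atlas Q e -> chart_cod c y ->
  chart_dom d (f (chart_inv c y)) -> chart_dom e (h (f (chart_inv c y))) ->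
  is_diff y (fun y => e (h (f (chart_inv c y))))
    (fun v => 'd (fun z => e (h (chart_inv d z))) (d (f (chart_inv c y)))
       ('d (fun y => d (f (chart_inv c y))) y v)).
Proof.
move=> sf sh Xc Yd Qe cy dy ey.
have [_ d1 _ _ _] := gY.1 _ Yd; have [dy' dyE] := d1 _ dy.
have [[_ oc] c1 _ _ c4] := gX.1 _ Xc.
have D1 := smooth_chart_diff sf Xc Yd cy dy.
have [[od _] _ _ _ _] := gY.1 _ Yd.
have D2 : is_diff (d (f (chart_inv c y))) (fun z => e (h (chart_inv d z)))
   ('d (fun z => e (h (chart_inv d z))) (d (f (chart_inv c y)))).
  by apply: (Ck_is_diff (sh.2 d e Yd Qe 1%N)); split => //=; rewrite dyE.
have D := is_diff_comp D1 D2.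
apply: is_diff_near D.
have cfc : {for y, continuous (fun y => f (chart_inv c y))}.
  by apply: continuous_comp; [exact: c4|exact: sf.1].
have : \forall y' \near y, chart_dom d (f (chart_inv c y')).
  by apply: cfc; exact: open_nbhs_nbhs.
by apply: filterS => y' /d1[_ /= ->].
Qed.

End Chain.

Lemma mdiff_comp (M N P : topologicalType) (V W Z : normedModType R)
    (X : charted M V) (Y : charted N W) (Q : charted P Z) (f : M -> N) (h : N -> P) x v :
  compatible_charts X -> compatible_charts Y -> compatible_charts Q ->
  smooth X Y f -> smooth Y Q h ->
  mdiff X Q (fun x => h (f x)) x v = mdiff Y Q h (f x) (mdiff X Y f x v).
Proof.
move=> gX gY gQ sf sh; have [Xc cx] := gX.2 x; have [Yd dx] := gY.2 (f x).
have [Qe ex] := gQ.2 (h (f x)).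
have [_ c1 _ _ _] := gX.1 _ Xc; have [cx' cxE] := c1 _ cx.
have D := @chart_chain _ _ _ _ _ _ X Y Q gX gY f h _ _ _ (chart_at X x x) sf sh Xc Yd Qe cx'.
rewrite cxE in D; have {}D := D dx ex.
by rewrite /mdiff (@diff_val _ _ _ _ _ _ _ D).
Qed.

End SmoothMaps.

(** * The averaged momentum map *)

Section AveragedMomentum.
Context {R : realType} {n k N : nat} {M : ptopologicalType} {G : topGroupType}.
Variables (XM : charted M (Cn R n)) (XG : charted G (Cn R N)).
Variables (act : G -> M -> M) (mu : M -> 'cV[R]_k) (nu : probability (borel M) R).
Hypotheses (cM : compact [set: M]) (gM : compatible_charts XM) (gG : compatible_charts XG).
Hypothesis act_smooth : smooth (prod_charted XG XM) XM (fun p => act p.1 p.2).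
Hypothesis mu_smooth : smooth XM (vcharted 'cV[R]_k) mu.

Definition pairing_fun (v : 'rV[R]_k) (xi : 'cV[R]_k) : R^o := pairing xi v.
Lemma pairing_linear (v : 'rV[R]_k) : linear (pairing_fun v).
Proof. by move=> a x y; rewrite /pairing_fun pairingD pairingZ. Qed.
HB.instance Definition _ v :=
  GRing.isLinear.Build R 'cV[R]_k R^o _ (pairing_fun v) (pairing_linear v).
Definition pairing_lin v : {linear 'cV[R]_k -> R^o} := pairing_fun v.

Lemma pairing_continuous v : continuous (pairing_lin v).
Proof.
have -> : (pairing_lin v : 'cV[R]_k -> R^o) = (fun x => \sum_i v 0 i * x i 0).
  by apply/funext => x; exact: pairing_sum.
apply: continuous_big => [|i _ x]; first exact: add_continuous.
apply: (@continuousM _ _ (fun=> v 0 i) (fun x : 'cV[R]_k => x i 0)).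
  exact: cst_continuous.
exact: coord_continuous.
Qed.

Let f v (b : G) (x : M) : R := pairing (mu (act b x)) v.

Lemma mu_pairing_smooth v : smooth XM (vcharted R^o) (fun x => pairing (mu x) v : R^o).
Proof.
split=> [x|c e Xc Qe k'].
  by apply: (@continuous_comp _ _ _ mu (pairing_lin v)); [exact: mu_smooth.1|exact: pairing_continuous].
rewrite Qe /=; have [[_ oc] _ _ _ _] := gM.1 _ Xc.
have H := mu_smooth.2 c (vchart _) Xc erefl k'.
have O : open (chart_cod c `&` chart_inv c @^-1` (mu @^-1` [set: 'cV[R]_k])).
  by rewrite !preimage_setT setIT.
have := Ck_linpost O (@pairing_continuous v) H.
by apply: Ck_sub => y [cy _]; split.
Qed.

Lemma act_left_smooth x : smooth XG XM (act ^~ x).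
Proof. exact: (smooth_slice x gG gM gM act_smooth). Qed.

Lemma act_right_smooth b : smooth XM XM (act b).
Proof. exact: (smooth_slice2 b gG gM gM act_smooth). Qed.

Lemma orbit_pairing_smooth v x : smooth XG (vcharted R^o) (fun b => f v b x : R^o).
Proof.
exact: (smooth_comp (Cn_frame n) gG gM (@vcharted_charts _ _) (act_left_smooth x) (mu_pairing_smooth v)).
Qed.

Lemma orbit_param v c : atlas XG c -> forall k',
  param_Ck XM (chart_cod c) k' (fun y x => f v (chart_inv c y) x).
Proof.
move=> Xc k' d Xd.
have := smooth_comp (Cn_frame n) (prod_charts gG gM) gM (@vcharted_charts _ _)
  act_smooth (mu_pairing_smooth v).
move=> [_ /(_ (prod_chart c d) (vchart _) _ erefl k')] /=.
have Xcd : atlas (prod_charted XG XM) (prod_chart c d) by exists c, d.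
by move=> /(_ Xcd); apply: Ck_sub => -[y z] [/= cy dz].
Qed.

Lemma orbit_continuous v b : continuous (f v b).
Proof.
move=> x; apply: (@continuous_comp _ _ _ (act b) (fun x => pairing (mu x) v)).
  exact: (act_right_smooth b).1.
exact: (mu_pairing_smooth v).1.
Qed.

Definition avg_pairing v (b : G) : R := \int[nu]_x (f v b : borel M -> R) x.

Lemma avg_pairing_is_diff v c y : atlas XG c -> chart_cod c y ->
  is_diff y (fun y => avg_pairing v (chart_inv c y) : R^o)
   (fun u => \int[nu]_x (fun x : borel M => 'd (fun y => f v (chart_inv c y) x : R^o) y u) x).
Proof.
move=> Xc cy; have [[_ oc] _ _ _ _] := gG.1 _ Xc.
exact: (param_integral_is_diff (Cn_frame N) nu cM gM oc (orbit_param v Xc) cy).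
Qed.

Lemma avg_pairing_Ck v c k' : atlas XG c ->
  Ck_on k' (chart_cod c) (fun y => avg_pairing v (chart_inv c y) : R^o).
Proof.
move=> Xc; have [[_ oc] _ _ _ _] := gG.1 _ Xc.
exact: (param_integral_smooth (Cn_frame N) nu cM gM oc (orbit_param v Xc)).
Qed.

Lemma Rintegral_sum (I : Type) (r : seq I) (h : I -> M -> R) :
  (forall i, continuous (h i)) ->
  \int[nu]_x (fun x : borel M => \sum_(i <- r) h i x) x =
  \sum_(i <- r) \int[nu]_x (h i : borel M -> R) x.
Proof.
move=> ch; elim: r => [|i r IH].
  rewrite big_nil; under eq_Rintegral do rewrite big_nil.
  by rewrite /Rintegral integral0.
rewrite big_cons -IH; under eq_Rintegral do rewrite big_cons.
rewrite RintegralD//.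
  exact: borel_integrable.
apply: (@borel_integrable _ _ _ cM (fun x => \sum_(j <- r) h j x)) => x.
by apply: cvg_big => [|j _]; [exact: add_continuous|exact: ch].
Qed.

Lemma Fnu_coord b i : Fnu act nu mu b i 0 = avg_pairing (delta_mx 0 i) b.
Proof.
rewrite /Fnu mxE /push_measure /avg_pairing /Rintegral; congr fine.
have cmu : continuous (fun x => mu x i 0).
  move=> x; apply: (@continuous_comp _ _ _ mu (fun xi : 'cV[R]_k => xi i 0)).
    exact: mu_smooth.1.
  exact: coord_continuous.
rewrite integral_pushforward //.
- rewrite preimage_setT; apply: eq_integral => x _; congr (_%:E).
  rewrite /f pairing_sum (bigD1 i)//= mxE !eqxx mul1r big1 ?addr0// => j ji.
  by rewrite mxE (negbTE ji) andbF mul0r.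
- apply: borel_measurable_self; exact: (act_right_smooth b).1.
- by apply/measurable_realfun.measurable_EFinP; exact: borel_measurable_fun.
- rewrite preimage_setT; apply: (@borel_integrable _ _ nu cM (fun x => mu (act b x) i 0)) => x.
  by apply: (@continuous_comp _ _ _ (act b) (fun x => mu x i 0)); [exact: (act_right_smooth b).1|exact: cmu].
Qed.

Lemma pairing_Fnu v b : pairing (Fnu act nu mu b) v = avg_pairing v b.
Proof.
have -> : avg_pairing v b = \sum_i \int[nu]_x (fun x : borel M => v 0 i * f (delta_mx 0 i) b x) x.
  rewrite -Rintegral_sum.
    apply: eq_Rintegral => x _; rewrite /f pairing_sum; apply: eq_bigr => i _.
    rewrite pairing_sum; congr (_ * _).
    rewrite (bigD1 i)//= mxE !eqxx mul1r big1 ?addr0// => j ji.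
    by rewrite mxE (negbTE ji) andbF mul0r.
  move=> i x; apply: continuousM; first exact: cst_continuous.
  exact: orbit_continuous.
rewrite pairing_sum; apply: eq_bigr => i _.
rewrite RintegralZl//; last by apply: borel_integrable => //; exact: orbit_continuous.
by rewrite Fnu_coord.
Qed.

(** In a chart of [G] the coordinates of [Fnu] are integrals of families that are
   smooth over the compact manifold [M]. *)
Lemma Fnu_smooth : smooth XG (vcharted 'cV[R]_k) (Fnu act nu mu).
Proof.
have CkF c k' : atlas XG c -> Ck_on k' (chart_cod c) (fun y => Fnu act nu mu (chart_inv c y)).
  move=> Xc; have [[_ oc] _ _ _ _] := gG.1 _ Xc.
  have -> : (fun y => Fnu act nu mu (chart_inv c y)) =
    (fun y => \sum_i (avg_pairing (delta_mx 0 i) (chart_inv c y) : R^o) *: (delta_mx i 0 : 'cV[R]_k)).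
    apply/funext => y; rewrite [LHS]matrix_sum_delta; apply: eq_bigr => i _.
    by rewrite big_ord1 Fnu_coord.
  apply: Ck_sum => // i; apply: CkZ => //; first exact: avg_pairing_Ck.
  exact: Ck_cst.
split=> [b|c d Xc -> k']; last by apply: Ck_sub (CkF c k' Xc) => y [].
have [Xc cb] := gG.2 b; set c := chart_at XG b in Xc cb.
have [[oc _] c1 _ c3 _] := gG.1 _ Xc; have [cb' cbE] := c1 _ cb.
have C := Ck_continuous (CkF c 0%N Xc) cb'.
have C2 : {for b, continuous (fun b => Fnu act nu mu (chart_inv c (c b)))}.
  by apply: (@continuous_comp _ _ _ c (fun y => Fnu act nu mu (chart_inv c y))) => //; exact: c3.
have E : Fnu act nu mu (chart_inv c (c b)) = Fnu act nu mu b by rewrite cbE.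
rewrite /prop_for /continuous_at in C2.
change (Fnu act nu mu b' @[b' --> b] --> Fnu act nu mu b); rewrite -[X in _ --> X]E.
apply: cvg_trans C2.
apply: near_eq_cvg.
have : \forall b' \near b, chart_dom c b' by exact: open_nbhs_nbhs.
by apply: filterS => b' /c1[_ ->].
Qed.

Lemma pairing_mdiff_Fnu v a u : pairing (mdiff XG (vcharted 'cV[R]_k) (Fnu act nu mu) a u) v =
  \int[nu]_x (fun x : borel M => mdiff XG (vcharted R^o) (fun b => f v b x : R^o) a u) x.
Proof.
have [Xc ca] := gG.2 a; have [_ c1 _ _ _] := gG.1 _ Xc; have [ca' _] := c1 _ ca.
have D1 := mdiff_is_diff gG (@vcharted_charts _ _) a Fnu_smooth.
have D2 := is_diff_lin (Fnu act nu mu (chart_inv (chart_at XG a) (chart_at XG a a)))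
  (@pairing_continuous v).
have D3 := is_diff_comp D1 D2.
have D4 := avg_pairing_is_diff v Xc ca'.
have E : (pairing_lin v \o (fun y => chart_at (vcharted 'cV[R]_k) (Fnu act nu mu a)
   (Fnu act nu mu (chart_inv (chart_at XG a) y)))) =
   (fun y => avg_pairing v (chart_inv (chart_at XG a) y) : R^o).
  by apply/funext => y /=; rewrite /pairing_lin /pairing_fun /= pairing_Fnu.
rewrite E in D3.
have := @diff_val _ _ _ _ _ _ _ D3; rewrite (@diff_val _ _ _ _ _ _ _ D4) => H.
exact: (esym (congr1 (fun h => h u) H)).
Qed.

Lemma mdiff_orbit_continuous v a u :
  continuous (fun x => mdiff XG (vcharted R^o) (fun b => f v b x : R^o) a u).
Proof.
have [Xc ca] := gG.2 a; have [[_ oc] c1 _ _ _] := gG.1 _ Xc; have [ca' _] := c1 _ ca.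
have := param_continuousr gM (param_diff gM oc u (orbit_param v Xc 1)) ca'.
exact.
Qed.

End AveragedMomentum.

(** * Integral curves of left-invariant fields *)

Lemma diff_scaleE (R : realType) (V W : normedModType R) (f : V -> W) x (a : R) v :
  'd f x (a *: v) = a *: 'd f x v.
Proof. exact: linearZ. Qed.

Section IntegralCurves.
Context {R : realType} {N : nat} {G : topGroupType}.
Variables (XG : charted G (Cn R N)).
Hypotheses (gG : compatible_charts XG).
Hypothesis mul_smooth : smooth (prod_charted XG XG) XG (fun p => p.1 * p.2)%g.

(** The curve [alpha] solves [alpha' = d L_alpha xi0], where [L] is left
   translation. The equation is stated after composition with an arbitrary
   smooth map [f] and a chart [d] of its target, the form in which it is used:
   the velocity of [f \o alpha] at [t] is the derivative at 1 along [xi0] of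
   [b |-> f (alpha t * b)]. *)
Definition left_integral_curve (xi0 : Cn R N) (e : R) (alpha : R -> G) :=
  alpha 0 = 1%g /\
  forall (P : topologicalType) (Z : normedModType R) (Q : charted P Z) (f : G -> P) d t,
    compatible_charts Q -> smooth XG Q f -> atlas Q d -> `|t| < e -> chart_dom d (f (alpha t)) ->
    {for t, continuous (fun t => f (alpha t))} /\
    is_diff (t : R^o) (fun t : R^o => d (f (alpha t)))
      (fun s => s *: 'd (fun z => d (f (alpha t * chart_inv (chart_at XG 1%g) z)%g))
                       (chart_at XG 1%g 1%g) xi0).

(** In the preferred chart [c] at 1 the left-invariant field is
   [W y = 'd m (y, c 1) (0, xi0)], where [m] is the multiplication read in [c]. It
   is C^1 because [m] is C^2, so it has an integral curve. *)
Lemma left_integral_curve_exists xi0 : exists2 e : R, 0 < e &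
  exists alpha, left_integral_curve xi0 e alpha.
Proof.
have [Xc c1'] := gG.2 1%g; set c := chart_at XG 1%g in Xc c1'.
have [[odc oc] cE c2 c3 c4] := gG.1 _ Xc; have [e0c e0E] := cE _ c1'.
pose e0 := c 1%g.
have Xcc : atlas (prod_charted XG XG) (prod_chart c c) by exists c, c.
pose A := chart_cod (prod_chart c c) `&` chart_inv (prod_chart c c) @^-1`
  ((fun p : G * G => (p.1 * p.2)%g) @^-1` chart_dom c).
pose m (q : Cn R N * Cn R N) := c (chart_inv c q.1 * chart_inv c q.2)%g.
have mCk k : Ck_on k A m by exact: mul_smooth.2.
have [[_ occ] _ _ _ ccc] := (prod_charts gG gG).1 _ Xcc.
have oA : open A.
  apply: (@open_preimage_on _ _ _ (fun q => (chart_inv c q.1 * chart_inv c q.2)%g)) => // q qc.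
  by apply: (@continuous_comp _ _ _ (chart_inv (prod_chart c c)) (fun p : G * G => (p.1 * p.2)%g));
    [exact: ccc|exact: mul_smooth.1].
have Ae y : chart_cod c y -> A (y, e0).
  move=> cy; split; first by split.
  by rewrite /= /e0 e0E mulg1; exact: (c2 _ cy).1.
pose U := [set y | A (y, e0)].
pose W y := 'd m (y, e0) (0, xi0).
have oU : open U.
  have cy0 := @pairl_continuous (Cn R N) (Cn R N) e0.
  exact: (@open_comp _ _ (fun y => (y, e0)) A (fun y _ => cy0 y) oA).
have W_C1 : Ck_on 1 U W.
  refine (@Ck_slice R (Cn R N) (Cn R N) (Cn R N) 1%N A (fun q => 'd m q (0, xi0)) e0
    oA ((mCk 2%N).2 (0, xi0))).
have [e e_gt0 [y [cy y0 Hy]]] := picard_local (Cn_frame N) oU (Ae _ e0c) W_C1.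
exists e => //; exists (fun t => chart_inv c (y t)); split; first by rewrite y0.
move=> P Z Q f d t gQ sf Qd te dt.
have [Uyt Dy] := Hy t te.
have cyt : chart_cod c (y t) := Uyt.1.1.
have Df := smooth_chart_diff sf Xc Qd cyt dt.
have Dm : is_diff e0 (fun z => m (y t, z)) (fun v => 'd m (y t, e0) (0, v)).
  have D1 : is_diff e0 (fun z : Cn R N => (y t, z)) (fun v => (0, v)).
    exact: is_diff_pair (is_diff_cst (y t) e0) (is_diff_id e0).
  exact: is_diff_comp D1 (Ck_is_diff (mCk 1%N) Uyt).
have me0 : m (y t, e0) = y t by rewrite /m /= /e0 e0E mulg1 (c2 _ cyt).2.
have Df' : is_diff (m (y t, e0)) (fun y => d (f (chart_inv c y)))
    ('d (fun y => d (f (chart_inv c y))) (y t)) by rewrite me0.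
have Dc := is_diff_comp Dm Df'.
have Dz : is_diff e0 (fun z => d (f (chart_inv c (y t) * chart_inv c z)%g))
   ('d (fun y => d (f (chart_inv c y))) (y t) \o (fun v => 'd m (y t, e0) (0, v))).
  apply: is_diff_near Dc.
  have : \forall z \near e0, A (y t, z).
    have cz := @pairr_continuous (Cn R N) (Cn R N) (y t).
    by apply: cz; exact: open_nbhs_nbhs.
  by apply: filterS => z [_ /= Az]; rewrite /m /= (cE _ Az).2.
have Ez := @diff_val _ _ _ _ _ _ _ Dz.
split.
- apply: (@continuous_comp _ _ _ (fun t => chart_inv c (y t)) f); last exact: sf.1.
  by apply: (@continuous_comp _ _ _ y (chart_inv c)); [exact: cy|exact: c4].
- have D := is_diff_comp Dy Df.
  apply: (is_diff_eq D); apply/funext => s /=.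
  apply: etrans (diff_scaleE _ _ _ _) _; apply: congr1.
  exact: (esym (congr1 (fun h => h xi0) Ez)).
Qed.

End IntegralCurves.

Section LocallyConstant.
Context {R : realType}.

(** The indicator of [f s = f 0] has zero derivative on the segment from 0 to [t],
   so it is constant there by the mean value theorem. *)
Lemma locally_constant (T : Type) (f : R -> T) (e : R) :
  (forall t, `|t| < e -> \forall s \near t, f s = f t) ->
  forall t, `|t| < e -> f t = f 0.
Proof.
move=> H t te.
pose g (s : R) : R^o := if pselect (f s = f 0) then 1 else 0.
have D (s : R) : 0 <= s <= 1 -> is_diff (0 + s *: t : R^o) g (fun=> 0).
  move=> /andP[s0 s1]; rewrite add0r.
  have st : `|s * t| < e.
    by apply: le_lt_trans te; rewrite normrM ger0_norm// ler_piMl.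
  apply: (is_diff_near _ (is_diff_cst (g (s * t)) (s * t : R^o))).
  by apply: filterS (H _ st) => r Er; rewrite /g Er.
have [s _] := MVT_dir D; rewrite add0r => E.
apply: contrapT => ft.
have g0 : g 0 = 1 by rewrite /g; case: pselect.
have gt : g t = 0 by rewrite /g; case: pselect.
by move: E => /eqP; rewrite g0 gt sub0r oppr_eq0 oner_eq0.
Qed.

Lemma zero_diff_constant (V : normedModType R) (B : frame V) (h : R -> V) (t r : R) :
  (forall s, `|t - s| < r -> is_diff (s : R^o) (h : R^o -> V) (fun=> 0)) ->
  forall s, `|t - s| < r -> h s = h t.
Proof.
move=> H s sr; apply: subr0_eq; rewrite (bdec B (h s - h t)) big1// => i _.
have D (a : R) : 0 <= a <= 1 -> is_diff (t + a *: (s - t) : R^o)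
    (fun s => bcoord B i (h s)) (fun=> 0).
  move=> /andP[a0 a1].
  have ar : `|t - (t + a *: (s - t))| < r.
    apply: le_lt_trans sr; rewrite opprD addNKr normrN normrM ger0_norm// distrC.
    by rewrite ler_piMl.
  have D1 := H _ ar.
  have D2 := is_diff_lin (h (t + a *: (s - t))) (bcoord_continuous B i).
  have D3 := is_diff_comp D1 D2.
  by apply: (is_diff_eq D3); apply/funext => x /=; rewrite linear0.
have [a _] := MVT_dir D; rewrite [t + (s - t)]addrC subrK => E.
by rewrite linearB [X in X *: _]E scale0r.
Qed.

End LocallyConstant.

Section FixedPoints.
Context {R : realType} {n N : nat} {M : topologicalType} {G : topGroupType}.
Variables (XM : charted M (Cn R n)) (XG : charted G (Cn R N)) (act : G -> M -> M).
Hypotheses (gM : compatible_charts XM) (gG : compatible_charts XG) (act_action : is_action act).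
Hypothesis act_smooth : smooth (prod_charted XG XM) XM (fun p => act p.1 p.2).

(** The velocity of [alpha t z] is the image by the differential of [act (alpha t)]
   of the value at [z] of the fundamental field, which is zero.
   This is why the curve is tangent to a left-invariant field: for a
   right-invariant one the velocity would be the fundamental field at
   [alpha t z], a point not yet known to be a zero of it. *)
Lemma curve_fixes xi0 e alpha z : left_integral_curve XG xi0 e alpha ->
  fundamental XG XM act xi0 z = 0 -> forall t, `|t| < e -> act (alpha t) z = z.
Proof.
move=> [a0 Ha] fz t te.
have sz : smooth XG XM (act ^~ z) := smooth_slice z gG gM gM act_smooth.
suff H : forall t, `|t| < e -> \forall s \near t, act (alpha s) z = act (alpha t) z.
  by rewrite (locally_constant H te) a0 act_action.1.
move=> {te}t te.
have [Xd dt] := gM.2 (act (alpha t) z); set d := chart_at XM _ in Xd dt.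
have [[od _] dE _ _ _] := gM.1 _ Xd.
have [ct _] := Ha _ _ XM (act ^~ z) d t gM sz Xd te dt.
have near_t : \forall s \near t, `|s| < e /\ chart_dom d (act (alpha s) z).
  apply: filterI.
    apply/nbhs_ballP; exists (e - `|t|) => /=; first by rewrite subr_gt0.
    move=> s; rewrite /ball /= => st; have := ler_normD (s - t) t; rewrite subrK.
    by rewrite distrC in st; lra.
  by apply: ct; exact: open_nbhs_nbhs.
have [r /= r0 Hr] := (nbhs_ballP _ _).1 near_t.
apply/nbhs_ballP; exists r => // s ts.
have const := @zero_diff_constant R _ (Cn_frame n) (fun s => d (act (alpha s) z)) t r.
have : d (act (alpha s) z) = d (act (alpha t) z).
  apply: const => // {ts}s ts; have [se ds] := Hr s ts.
  have [_ D] := Ha _ _ XM (act ^~ z) d s gM sz Xd se ds.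
  apply: (is_diff_eq D); apply/funext => x.
  have sa : smooth XM XM (act (alpha s)) := smooth_slice2 (alpha s) gG gM gM act_smooth.
  have [Xc cc] := gG.2 1%g; have [_ cE _ _ _] := gG.1 _ Xc; have [cc' ccE] := cE _ cc.
  have [Xe ez] := gM.2 (act 1%g z).
  have C := @chart_chain _ _ _ _ _ _ _ XG XM XM gG gM (act ^~ z) (act (alpha s))
    _ _ d _ sz sa Xc Xe Xd cc'.
  rewrite ccE in C; have {}C := C ez.
  have ds' : chart_dom d (act (alpha s) (act 1%g z)) by rewrite act_action.1.
  have {}C := C ds'.
  have -> : (fun w => d (act (alpha s * chart_inv (chart_at XG 1%g) w)%g z)) =
    (fun w => d (act (alpha s) (act (chart_inv (chart_at XG 1%g) w) z))).
    by apply/funext => w; rewrite act_action.2.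
  rewrite (@diff_val _ _ _ _ _ _ _ C).
  rewrite -[X in 'd _ _ X]/(fundamental XG XM act xi0 z) fz linear0.
  by rewrite scaler0.
move=> E; have [_ ds] := Hr s ts.
by rewrite -(dE _ ds).2 E (dE _ dt).2.
Qed.

End FixedPoints.

(** * Submersion and image *)

Lemma is_diff_max (R : realType) (V : normedModType R) (f : V -> R^o) x df v :
  is_diff x f df -> (\forall y \near x, f y <= f x) -> df v = 0.
Proof.
move=> D fmax; have dfx := @ex_diff _ _ _ _ _ _ _ D.
rewrite -(@diff_val _ _ _ _ _ _ _ D) => {D}.
suff le0 u : 'd f x u <= 0.
  by apply/eqP; rewrite eq_le le0 /= -oppr_le0 -linearN le0.
rewrite leNgt; apply/negP => d0; set d := 'd f x u in d0.
pose c := `|u| + 1; have c0 : 0 < c by rewrite ltr_wpDl.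
have [w w0 dE] : exists2 w, 0 < w & d = w * (2 * c).
  by exists (d / (2 * c)); rewrite ?divr_gt0 ?mulr_gt0// divfK// gt_eqF// mulr_gt0.
have fmax0 : \forall h \near 0, f (h + x) <= f x.
  by move: fmax; rewrite (near_shift 0) /= subr0; apply: filterS.
have near0 : \forall h \near 0, f (h + x) <= f x /\
    `|f (h + x) - f x - 'd f x h| <= w * `|h|.
  by apply: filterI => //; exact: is_diff_epsP.
have [r /= r0 Hr] := (nbhs_ballP _ _).1 near0.
pose t := r / (2 * c); have t0 : 0 < t by rewrite divr_gt0// mulr_gt0.
have rE : r = t * (2 * c) by rewrite /t divfK// gt_eqF// mulr_gt0.
have tu : `|t *: u| = t * `|u| by rewrite normrZ gtr0_norm.
have [] := Hr (t *: u).
  rewrite -ball_normE /= sub0r normrN tu rE.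
  have : 0 < t * (`|u| + 2) by rewrite mulr_gt0// ltr_wpDl.
  by rewrite /c; lra.
rewrite linearZ tu -[X in f _ - f x - X]/(t * d) => f1.
rewrite ler_norml => /andP[f2 _].
have : t * d <= w * (t * `|u|) by lra.
rewrite [leRHS]mulrCA ler_pM2l// dE.
have : 0 < w * (`|u| + 2) by rewrite mulr_gt0// ltr_wpDl.
by rewrite /c; lra.
Qed.

Section MomentumOfMeasure.
Context {R : realType} {n k N : nat} {M : ptopologicalType}.
Variables (XM : charted M (Cn R n)) (g : M -> Cn R n -> Cn R n -> R).
Variables (K : topGroupType) (XK : charted K 'rV[R]_k).
Variables (G : topGroupType) (XG : charted G (Cn R N)) (iota : K -> G).
Variables (actK : K -> M -> M) (actG : G -> M -> M).
Variables (mu : M -> 'cV[R]_k) (nu : probability (borel M) R).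
Hypotheses (cM : compact [set: M]) (hM : hausdorff_space M).
Hypotheses (gM : compatible_charts XM) (gG : compatible_charts XG).
Hypothesis mul_smooth : smooth (prod_charted XG XG) XG (fun p => p.1 * p.2)%g.
Hypothesis g_pos : forall x u, u != 0 -> 0 < g x u u.
Hypothesis g_lin : forall x a u v w, g x (a *: u + v) w = a * g x u w + g x v w.
Hypothesis eff : forall v, (forall x, fundamental XK XM actK v x = 0) -> v = 0.
Hypothesis mu_smooth : smooth XM (vcharted 'cV[R]_k) mu.
Hypothesis act_action : is_action actG.
Hypothesis act_smooth : smooth (prod_charted XG XM) XM (fun p => actG p.1 p.2).
Hypothesis imaginary : forall v x,
  fundamental XG XM actG (Ji (mdiff XK XG iota 1%g v)) x = Ji (fundamental XK XM actK v x).
Hypothesis gradient : forall v, is_gradient XM g (fun x => pairing (mu x) v)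
  (fun x => Ji (fundamental XK XM actK v x)).
Hypothesis nu_stabilizer : compact (stabilizer actG nu).

Let vM v x := fundamental XK XM actK v x.
Let q v x := g x (Ji (vM v x)) (Ji (vM v x)).
Let xi0 v := Ji (mdiff XK XG iota 1%g v).

Let q_ge0 v x : 0 <= q v x.
Proof.
have [J0|u0] := eqVneq (Ji (vM v x)) 0; rewrite /q; last exact/ltW/g_pos.
by rewrite J0; have := g_lin x 1 0 0 0; rewrite scaler0 addr0 mul1r => ?; lra.
Qed.

Let q_eq0 v x : q v x = 0 -> vM v x = 0.
Proof.
move=> q0; have [J0|u0] := eqVneq (Ji (vM v x)) 0; last first.
  by have := g_pos x u0; rewrite -/(q v x) q0 ltxx.
have := J0; case: (vM v x) => a b /=; rewrite /Ji /= => -[/eqP]; rewrite oppr_eq0 => /eqP -> ->.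
by [].
Qed.

(** Along [i v] the momentum [mu^v] grows at the rate given by the square of the
   length of its gradient [J v_M]. *)
Lemma momentum_derivative v y : mdiff XG (vcharted R^o) (fun b => pairing (mu (actG b y)) v : R^o) 1%g (xi0 v)
  = q v y.
Proof.
have sy := act_left_smooth gM gG act_smooth y.
have sm := mu_pairing_smooth gM mu_smooth v.
have := @mdiff_comp _ _ _ _ _ _ _ XG XM (vcharted R^o) _ _ 1%g (xi0 v) gG gM (@vcharted_charts _ _) sy sm.
rewrite -[mdiff XG XM _ _ _]/(fundamental XG XM actG (xi0 v) y) imaginary act_action.1.
by rewrite -(gradient v) => ->.
Qed.

(** The hypothesis says that [a_* nu] is carried by the zero set [Z] of [v_M]. Let
   [P] be the group of the elements fixing [Z] pointwise. It is closed, and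
   [a^-1 P a] stabilizes [nu], so [P] is compact; it contains the integral curve
   of [i v] through 1. On an orbit of [P] the function [mu^v] then has a
   maximum [y]. Moving [y] along the curve cannot increase [mu^v], so [v_M]
   vanishes at [y], that is, [y] is in [Z] and is fixed by [P]. The orbit is
   reduced to [y], so [v_M] vanishes at every point of [M]. *)
Lemma fixed_ae_eq0 v a : nu [set x | vM v (actG a x) != 0] = 0%E ->
  measurable ([set x | vM v (actG a x) != 0] : set (borel M)) -> v = 0.
Proof.
move=> nu0 mA.
pose Z := [set z | vM v z = 0].
pose P := [set b | forall z, Z z -> actG b z = z].
have [e e0 [alpha Ha]] := left_integral_curve_exists gG mul_smooth (xi0 v).
have alphaP t : `|t| < e -> P (alpha t).
  move=> te z Zz; apply: (curve_fixes gM gG act_action act_smooth Ha) => //.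
  by rewrite imaginary -/(vM v z) Zz /Ji oppr0.
have actK' a' x : actG a'^-1%g (actG a' x) = x.
  by rewrite -act_action.2 mulVg act_action.1.
have Pmul b c : P b -> P c -> P (b * c)%g.
  by move=> Pb Pc z Zz; rewrite act_action.2 Pc// Pb.
have Pinv b : P b -> P b^-1%g.
  by move=> Pb z Zz; rewrite -{1}(Pb z Zz) actK'.
have cact b : continuous (actG b) := (act_right_smooth gM gG act_smooth b).1.
have Pstab b : P b -> stabilizer actG nu (a^-1 * b * a)%g.
  move=> Pb E mE; rewrite /push_measure /pushforward.
  set A := [set x | vM v (actG a x) != 0] in nu0 mA.
  have mE' : measurable ((actG (a^-1 * b * a)%g : borel M -> borel M) @^-1` E).
    rewrite -[X in measurable X]setTI.
    exact: (borel_measurable_self (cact _)).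
  (* off the null set A the element a^-1 b a moves no point *)
  have H (S : set (borel M)) : measurable S -> nu S = nu (S `&` ~` A).
    move=> mS; rewrite -setDE (measureDI _ mS mA) [X in (_ + X)%E](_ : _ = 0%E) ?adde0//.
    by apply: (subset_measure0 _ _ _ nu0) => //; exact: measurableI.
  rewrite (H _ mE') (H _ mE); congr (nu _); apply/seteqP; split => x /= [Ex nAx]; split => //.
    move: Ex; rewrite !act_action.2 Pb ?actK'//.
    by rewrite /Z /=; apply/eqP; move/negP: nAx; rewrite negbK.
  rewrite !act_action.2 Pb ?actK'//.
  by rewrite /Z /=; apply/eqP; move/negP: nAx; rewrite negbK.
have Pcompact : compact P.
  apply: (@subclosed_compact _ _ ((fun s => (a * s * a^-1)%g) @` stabilizer actG nu)).
  - have -> : P = \bigcap_(z in Z) [set b | actG b z = z] by [].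
    apply: closed_bigI => z Zz.
    have -> : [set b | actG b z = z] = (actG ^~ z) @^-1` [set z] by [].
    apply: closed_comp => [b _|]; first exact: (act_left_smooth gM gG act_smooth z).1.
    exact: accessible_closed_set1 (hausdorff_accessible hM) _.
  - apply: continuous_compact => //; apply: continuous_subspaceT => s.
    have sl := smooth_slice2 a gG gG gG mul_smooth.
    have sr := smooth_slice (a^-1)%g gG gG gG mul_smooth.
    apply: (@continuous_comp _ _ _ (fun s => (a * s)%g) (fun s => (s * a^-1)%g)).
      exact: sl.1.
    exact: sr.1.
  - move=> b Pb; exists (a^-1 * b * a)%g; first exact: Pstab.
    by rewrite !mulgA mulgV mul1g mulgK.
apply: eff => x; rewrite -/(vM v x).
have cf : continuous (fun b => pairing (mu (actG b x)) v : R^o).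
  exact: (orbit_pairing_smooth gM gG act_smooth mu_smooth v x).1.
have [p0 /set_mem Pp0 maxp] : exists2 c, c \in P & forall t, t \in P ->
    pairing (mu (actG t x)) v <= pairing (mu (actG c x)) v.
  apply: compact_EVT_max => //; first by exists 1%g => z _; exact: act_action.1.
  exact: continuous_subspaceT.
pose y := actG p0 x.
have qy : q v y = 0.
  have e00 : `|0 : R| < e by rewrite normr0.
  have Qd : atlas (vcharted R^o) (vchart R^o) by [].
  have [_ D] := Ha.2 _ _ (vcharted R^o) (fun b => pairing (mu (actG b y)) v : R^o) (vchart _) 0
    (@vcharted_charts _ _) (orbit_pairing_smooth gM gG act_smooth mu_smooth v y) Qd e00 I.
  have hmax : \forall t \near (0 : R^o), pairing (mu (actG (alpha t) y)) v <=
      pairing (mu (actG (alpha 0) y)) v.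
    apply/nbhs_ballP; exists e => // t; rewrite /ball /= sub0r normrN => te.
    rewrite Ha.1 act_action.1 /y -act_action.2.
    by apply: maxp; apply/mem_set/Pmul => //; exact: alphaP.
  have := is_diff_max (1 : R^o) D hmax; rewrite scale1r -momentum_derivative /mdiff /= Ha.1 => <-.
  by congr ('d _ _ _); apply/funext => z; rewrite mul1g.
have Zy : Z y by exact: q_eq0.
have : actG p0^-1%g y = y by apply: Pinv.
by rewrite actK' => ->.
Qed.

(** The witness is the velocity at [a] of the right translate by [a] of a curve
   tangent to [i v] at 1. *)
Lemma speed_direction v a : exists u, forall x,
  mdiff XG (vcharted R^o) (fun b => pairing (mu (actG b x)) v : R^o) a u = q v (actG a x).
Proof.
have sr := smooth_slice a gG gG gG mul_smooth.
exists (mdiff XG XG (fun b => b * a)%g 1%g (xi0 v)) => x.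
have := @mdiff_comp _ _ _ _ _ _ _ XG XG (vcharted R^o) _ _ 1%g (xi0 v) gG gG (@vcharted_charts _ _) sr
  (orbit_pairing_smooth gM gG act_smooth mu_smooth v x).
rewrite /= mul1g => <-; rewrite -momentum_derivative.
by congr (mdiff _ _ _ _ _); apply/funext => b; rewrite act_action.2.
Qed.

(** A continuous nonnegative function of integral zero vanishes almost everywhere.
   Its continuity in [x] comes from its being a parameter derivative. *)
Lemma speed_integral_eq0 v a u : (forall x,
    mdiff XG (vcharted R^o) (fun b => pairing (mu (actG b x)) v : R^o) a u = q v (actG a x)) ->
  \int[nu]_x (fun x : borel M => q v (actG a x)) x = 0 -> v = 0.
Proof.
move=> Hu I0.
have cq : continuous (fun x => q v (actG a x)).
  have <- : (fun x => mdiff XG (vcharted R^o) (fun b => pairing (mu (actG b x)) v : R^o) a u) =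
      (fun x => q v (actG a x)) by apply/funext => x; exact: Hu.
  exact: mdiff_orbit_continuous gM gG act_smooth mu_smooth v a u.
have EA : [set x | vM v (actG a x) != 0] = [set x | q v (actG a x) != 0].
  apply/seteqP; split=> x /=; apply: contraNN => /eqP E; first by rewrite (q_eq0 E).
  apply/eqP; rewrite /q E; have := g_lin (actG a x) 1 0 0 (Ji 0).
  by rewrite /Ji /= oppr0 -[(0, 0)]/(0 : Cn R n) scaler0 addr0 mul1r => ?; lra.
have mA : measurable ([set x | q v (actG a x) != 0] : set (borel M)).
  apply: borel_open; apply: (@open_comp _ _ (fun x => q v (actG a x)) [set r : R | r != 0]).
    by move=> x _; exact: cq.
  exact: open_neq.
apply: (@fixed_ae_eq0 v a); rewrite EA//.
apply: measure_negligible => //.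
have fi := borel_integrable nu cM cq.
have fn := integrable_fin_num (measurableT : measurable [set: borel M]) fi.
have : (\int[nu]_x `|(q v (actG a x))%:E| = 0)%E.
  under eq_integral do rewrite gee0_abs ?lee_fin//.
  by rewrite -[LHS]fineK//; congr (_%:E); exact: I0.
move=> /(ae_eq_integral_abs _ measurableT)[].
  by apply/measurable_realfun.measurable_EFinP; exact: borel_measurable_fun.
move=> B [mB B0 AB]; exists B; split => // x /= qx; apply: AB => /= H.
by move/eqP : qx; apply; have /= [] := H I.
Qed.

Let Fsm := Fnu_smooth nu cM gM gG act_smooth mu_smooth.

(** Evaluated at the direction of [speed_direction], the hypothesis says that the
   integral of the squared speed over [a_* nu] is zero. *)
Lemma pairing_mdiff_eq0 v a : (forall u,
    pairing (mdiff XG (vcharted 'cV[R]_k) (Fnu actG nu mu) a u) v = 0) -> v = 0.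
Proof.
move=> H; have [u Hu] := speed_direction v a.
apply: (speed_integral_eq0 Hu).
have := H u; rewrite (pairing_mdiff_Fnu nu cM gM gG act_smooth mu_smooth) => <-.
by apply: eq_Rintegral => x _; rewrite Hu.
Qed.

(** If the range were proper, it would lie in a half-space, being a cone, and a
   functional bounded above on a linear subspace vanishes on it. *)
Lemma Fnu_mdiff_surjective a w : exists u, mdiff XG (vcharted 'cV[R]_k) (Fnu actG nu mu) a u = w.
Proof.
apply: contrapT => nw.
pose L : {linear Cn R N -> 'cV[R]_k} := 'd (fun y => chart_at (vcharted 'cV[R]_k) (Fnu actG nu mu a)
   (Fnu actG nu mu (chart_inv (chart_at XG a) y))) (chart_at XG a a).
pose D := range L.
have coneD : cone D.
  split=> [_ _ [u _ <-] [u' _ <-]|t _ t0 [u _ <-]].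
    by exists (u + u') => //; rewrite linearD.
  by exists (t *: u) => //; exact: linearZ.
have nD : ~ D w by move=> [u _ E]; apply: nw; exists u.
have [|v v0 Hv] := cone_half_space coneD _ nD; first by exists (L 0), 0.
move/eqP : v0; apply; apply: (@pairing_mdiff_eq0 v a) => u.
have h1 : pairing (L u) v <= 0 by apply: Hv; exists u.
have h2 : pairing (L (- u)) v <= 0 by apply: Hv; exists (- u).
rewrite linearN -scaleN1r pairingZ in h2.
by change (pairing (L u) v = 0); lra.
Qed.

Lemma Fnu_submersion : submersion XG (vcharted 'cV[R]_k) (Fnu actG nu mu).
Proof. by split; [exact: Fsm|exact: Fnu_mdiff_surjective]. Qed.

(** Were [F a] outside the interior of the hull, some nonzero [v] would satisfy
   [mu^v <= <F a, v>] on [M]. Averaging over [b_* nu] gives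
   [<F b, v> <= <F a, v>] for all [b], so that the functional [v] is critical at
   [a] along [F], contrary to [pairing_mdiff_eq0]. *)
Lemma Fnu_image : range (Fnu actG nu mu) `<=` Omega mu.
Proof.
move=> _ [a _ <-]; apply: contrapT => nO.
have hull_mu x : convex_hull (range mu) (mu x).
  by move=> C [/= _ sC]; apply: sC; exists x.
have [|v v0 Hv] := supporting_functional (@convex_hull_convex _ _ _) _ nO.
  by exists (mu (point : M)); exact: hull_mu.
move/eqP : v0; apply; apply: (@pairing_mdiff_eq0 v a) => u.
have Fle b : pairing (Fnu actG nu mu b) v <= pairing (Fnu actG nu mu a) v.
  rewrite (pairing_Fnu nu cM gM gG act_smooth mu_smooth v b) /avg_pairing.
  have -> : pairing (Fnu actG nu mu a) v =
      \int[nu]_(x in [set: borel M]) (cst (pairing (Fnu actG nu mu a) v)) x :> R.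
    by rewrite Rintegral_cst//= probability_setT mulr1.
  apply: le_Rintegral => //.
  - by apply: borel_integrable => //; exact: orbit_continuous gM gG act_smooth mu_smooth v b.
  - by apply: (@borel_integrable _ _ nu cM (cst (pairing (Fnu actG nu mu a) v))); exact: cst_continuous.
  - by move=> x _; exact: Hv.
have D1 := mdiff_is_diff gG (@vcharted_charts _ _) a Fsm.
have D2 := is_diff_lin (Fnu actG nu mu (chart_inv (chart_at XG a) (chart_at XG a a)))
  (@pairing_continuous _ _ v).
have D3 := is_diff_comp D1 D2.
have [Xc ca] := gG.2 a; have [_ c1 _ _ _] := gG.1 _ Xc; have [_ caE] := c1 _ ca.
apply: (is_diff_max u D3); apply/nbhs_ballP; exists 1 => [|y _] /=; first exact: ltr01.
by rewrite caE; exact: Fle.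
Qed.

End MomentumOfMeasure.

Theorem theorem6p4 (R : realType) (n k N : nat)
  (M : ptopologicalType) (XM : charted M (Cn R n))
  (g : M -> Cn R n -> Cn R n -> R)
  (K : topGroupType) (XK : charted K 'rV[R]_k)
  (G : topGroupType) (XG : charted G (Cn R N)) (iota : K -> G)
  (actK : K -> M -> M) (actG : G -> M -> M)
  (mu : M -> 'cV[R]_k) (nu : probability (borel M) R)
  (M_compact : compact [set: M])
  (M_kaehler : kaehler XM g)
  (K_lie : lie_group XK)
  (K_compact : compact [set: K])
  (K_connected : connected [set: K])
  (G_complexification : complexification XK XG iota)
  (actK_action : is_action actK)
  (actK_smooth : smooth (prod_charted XK XM) XM (fun p => actK p.1 p.2))
  (actK_almost_effective : forall v,
     (forall x, fundamental XK XM actK v x = 0) -> v = 0)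
  (actK_isometries : forall a, holomorphic_isometry XM g (actK a))
  (mu_momentum : momentum_map XK XM g actK mu)
  (actG_action : is_action actG)
  (actG_holomorphic :
     holomorphic (prod_charted XG XM) XM Jprod Ji (fun p => actG p.1 p.2))
  (actG_extends : forall a x, actG (iota a) x = actK a x)
  (actG_imaginary : forall v x,
     fundamental XG XM actG (Ji (mdiff XK XG iota 1%g v)) x
     = Ji (fundamental XK XM actK v x))
  (actG_gradient : forall v,
     is_gradient XM g (fun x => pairing (mu x) v)
       (fun x => Ji (fundamental XK XM actK v x)))
  (nu_stabilizer : compact (stabilizer actG nu)) :
  submersion XG (vcharted 'cV[R]_k) (Fnu actG nu mu)
  /\ range (Fnu actG nu mu) `<=` Omega mu.
Proof.
have [[manM _] [g_lin _ g_pos _] _ _] := M_kaehler.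
have [[manG _] [mul_smooth _] _] : complex_lie_group XG by case: G_complexification.
have gM := manifold_charts manM; have gG := manifold_charts manG.
have hM : hausdorff_space M by case: manM => -[].
have [mu_smooth _ _] := mu_momentum.
have act_smooth := actG_holomorphic.1.
split.
- exact: (Fnu_submersion M_compact hM gM gG mul_smooth g_pos g_lin actK_almost_effective
    mu_smooth actG_action act_smooth actG_imaginary actG_gradient nu_stabilizer).
- exact: (Fnu_image M_compact hM gM gG mul_smooth g_pos g_lin actK_almost_effective
    mu_smooth actG_action act_smooth actG_imaginary actG_gradient nu_stabilizer).
Qed.
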